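(* Let $A\in\mathbb{R}^{n\times n}$, $C\in\mathbb{R}^{m\times n}$ with $(C,A)$ observable, and consider the leader $\dot x_0(t)=Ax_0(t)$, $y_0(t)=Cx_0(t)$, $t\ge0$, together with $N$ followers communicating over the switching graph $\bar{\mathcal G}_{\sigma(t)}$ described in the context. Assume (i) the subgraph $\mathcal G_{\sigma(t)}$ is undirected for all $t\ge0$, and (ii) there exist $T_{\mathrm c}>0$ and a subsequence $\{t_{j_k}\}$ of the switching instants with $t_{j_0}=0$ and $t_{j_{k+1}}-t_{j_k}\le T_{\mathrm c}$ for all $k$, such that for every $k$ every node $i\in\{1,\dots,N\}$ is reachable from node $0$ in the union graph $\bigcup_{t_j\in[t_{j_k},t_{j_{k+1}})}\bar{\mathcal G}_{\sigma(t_j)}$. Let $\delta\in(0,1)$ satisfy $\left\|\prod_{r=j_k}^{j_{k+1}-1}P_{\sigma(t_r)}\right\|\le\delta$ for all $k=0,1,2,\dots$. If $\lambda_{\max}(A)<-\ln\delta/T_{\mathrm c}$, then there exists $L\in\mathbb{R}^{n\times m}$ such that, for the distributed observer $$\dot\eta_i(t)=A\eta_i(t)+LC\sum_{j=0}^N a_{ij}(t)\,(\eta_j(t)-\eta_i(t)),\quad i=1,\dots,N,\qquad \eta_0(t)=x_0(t),$$ for all initial conditions $x_0(0),\eta_1(0),\dots,\eta_N(0)\in\mathbb{R}^n$ the solutions exist on $[0,\infty)$ and $\eta_i(t)-x_0(t)\to0$ exponentially as $t\to\infty$ for every $i=1,\dots,N$.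
   Context: A piecewise constant switching signal is a map $\sigma:[0,\infty)\to\mathcal P=\{1,\dots,n_0\}$ for which there are switching instants $0=t_0<t_1<\cdots$ and a dwell time $\tau>0$ with $t_{j+1}-t_j\ge\tau$, such that $\sigma$ is constant on each $[t_j,t_{j+1})$. For each $p\in\mathcal P$, $\bar{\mathcal G}_p$ is a graph on node set $\{0,1,\dots,N\}$ with edge set $\bar{\mathcal E}_p$ of ordered pairs $(j,i)$, $j\ne i$. $a_{ij}(t)=1$ if $(j,i)\in\bar{\mathcal E}_{\sigma(t)}$, else $0$. $\mathcal G_{\sigma(t)}$ is the subgraph on $\{1,\dots,N\}$ with the edges of $\bar{\mathcal E}_{\sigma(t)}$ among these nodes; undirected means $(i,j)$ is an edge iff $(j,i)$ is. Its Laplacian $\mathcal L_{\sigma(t)}$ has $l_{ii}=\sum_{j=1}^Na_{ij}(t)$, $l_{ij}=-a_{ij}(t)$ for $i\ne j$. $\Delta_{\sigma(t)}=\mathrm{diag}(a_{10}(t),\dots,a_{N0}(t))$, $\mathcal H_{\sigma(t)}=\mathcal L_{\sigma(t)}+\Delta_{\sigma(t)}$, and $P_{\sigma(t)}$ is the orthogonal projection of $\mathbb{R}^N$ onto $\ker\mathcal H_{\sigma(t)}$ (zero if the kernel is trivial). Node $i$ is reachable from $0$ if there are edges $(0,i_2),(i_2,i_3),\dots,(i_s,i)$; a union graph has the union of the edge sets. $\prod_{r=m}^n\Xi_r=\Xi_n\cdots\Xi_m$. $\|\cdot\|$ is the induced Euclidean norm; $\lambda_{\max}(A)$ is the largest real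 part of eigenvalues of $A$. *)

(* Defs.v *)
From HB Require Import structures.
From mathcomp Require Import all_boot all_order all_algebra.
From mathcomp Require Import all_classical all_reals all_analysis.
From mathcomp Require Import complex.
Set Implicit Arguments.
Unset Strict Implicit.
Unset Printing Implicit Defensive.
Import Order.TTheory GRing.Theory Num.Theory.
Import numFieldNormedType.Exports.
Local Open Scope ring_scope.
Local Open Scope classical_set_scope.

Definition observable (R : fieldType) (n m : nat) (C : 'M[R]_(m, n)) (A : 'M[R]_n) : Prop :=
  \rank (\mxcol_(k < n) (C *m A ^+ k)) = n.

Definition eigenvalueC (R : rcfType) (n : nat) (A : 'M[R]_n) (z : R[i]) : Prop :=
  root (map_poly (real_complex R) (char_poly A)) z.

Definition lambda_max_lt (R : rcfType) (n : nat) (A : 'M[R]_n) (c : R) : Prop :=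
  forall z : R[i], eigenvalueC A z -> complex.Re z < c.

Definition enorm (R : rcfType) (n : nat) (v : 'cV[R]_n) : R :=
  Num.sqrt (\sum_(i < n) v i 0 ^+ 2).

Definition opnorm (R : realType) (n : nat) (M : 'M[R]_n) : R :=
  sup [set enorm (M *m v) | v in [set v : 'cV[R]_n | enorm v <= 1]].

Definition orth_proj_ker (R : fieldType) (N : nat) (H P : 'M[R]_N) : Prop :=
  P^T = P /\ P *m P = P /\
  (forall v : 'cV[R]_N, H *m v = 0 <-> P *m v = v).

(* Nodes {0,...,N} are 'I_N.+1; follower i : 'I_N is node (lift ord0 i), i.e. i+1.
   Ebar p j i  <->  (j, i) is an edge of the graph bar G_p. *)
Definition node (N : nat) (i : 'I_N) : 'I_N.+1 := lift ord0 i.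

Definition adj (R : pzRingType) (N n0 : nat) (Ebar : 'I_n0 -> rel 'I_N.+1)
  (p : 'I_n0) (i j : 'I_N.+1) : R := (Ebar p j i)%:R.

Definition lapl (R : pzRingType) (N n0 : nat) (Ebar : 'I_n0 -> rel 'I_N.+1) (p : 'I_n0)
  : 'M[R]_N :=
  \matrix_(i < N, k < N)
    (if i == k then \sum_(j < N) adj R Ebar p (node i) (node j)
     else - adj R Ebar p (node i) (node k)).

Definition Delta (R : pzRingType) (N n0 : nat) (Ebar : 'I_n0 -> rel 'I_N.+1) (p : 'I_n0)
  : 'M[R]_N :=
  \matrix_(i < N, k < N) (if i == k then adj R Ebar p (node i) ord0 else 0).

Definition Hmat (R : pzRingType) (N n0 : nat) (Ebar : 'I_n0 -> rel 'I_N.+1) (p : 'I_n0)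
  : 'M[R]_N := lapl R Ebar p + Delta R Ebar p.

Definition has_deriv_at (R : realType) (n : nat) (f : R -> 'cV[R]_n) (t : R)
  (df : 'cV[R]_n) : Prop :=
  forall i : 'I_n, is_derive t (1 : R) (fun s => f s i 0) (df i 0).

Definition cont_on_nonneg (R : realType) (n : nat) (f : R -> 'cV[R]_n) : Prop :=
  forall i : 'I_n, {within [set s : R | 0 <= s], continuous (fun s => f s i 0)}.

(* A solution on [0,oo) of the closed loop: eta ord0 is the leader x0, eta (node i) = eta_i.
   Solutions are continuous on [0,oo); the leader satisfies x0' = A x0 for t > 0; the
   followers satisfy the observer equation at every t > 0 that is not a switching
   instant (the right-hand side is piecewise continuous in t). *)
Definition is_solution (R : realType) (n m N n0 : nat) (A : 'M[R]_n) (C : 'M[R]_(m, n))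
  (L : 'M[R]_(n, m)) (Ebar : 'I_n0 -> rel 'I_N.+1) (sigma : R -> 'I_n0)
  (tsw : nat -> R) (eta : 'I_N.+1 -> R -> 'cV[R]_n) : Prop :=
  (forall k, cont_on_nonneg (eta k)) /\
  (forall t, 0 < t -> has_deriv_at (eta ord0) t (A *m eta ord0 t)) /\
  (forall (i : 'I_N) t, 0 < t -> (forall r, t <> tsw r) ->
     has_deriv_at (eta (node i)) t
       (A *m eta (node i) t +
        L *m C *m \sum_(j < N.+1)
            adj R Ebar (sigma t) (node i) j *: (eta j t - eta (node i) t))).

(* Main.v *)
(** Write [E] for the matrix whose columns are the observer errors
    [eta_i - x_0]; on each switching interval [E' = A E - L C E H] with [H]
    symmetric positive semidefinite.  The part [E P] of [E] in the kernel of [H]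
    evolves by the flow of [A], which grows at most like [exp (beta t)],
    [beta < - ln delta / Tc], in a suitable Euclidean norm (Schur form with small
    off-diagonal entries).  For the part [E (1 - P)] the injection is coercive,
    and a high-gain [L], built from a Lyapunov form whose conditioning degrades
    only polynomially in the decay rate, makes it an arbitrarily small fraction
    of [E] after one dwell time.  Over a cycle [E] is therefore multiplied, up to
    an arbitrarily small error, by the flow of [A] on the left and by the
    transposed product of the projections on the right, so its norm shrinks by a
    factor close to [delta * exp (beta Tc) < 1]. *)
Require Import Defs.
From HB Require Import structures.
From mathcomp Require Import all_boot all_order all_algebra.
From mathcomp Require Import all_classical all_reals all_analysis.
From mathcomp Require Import complex ring lra zify.
Import Order.TTheory GRing.Theory Num.Theory.
Local Open Scope ring_scope.

Set Implicit Arguments.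
Unset Strict Implicit.
Unset Printing Implicit Defensive.
Import numFieldNormedType.Exports.

(** * The Frobenius inner product *)

(** The flow of [A] acts on the error matrix from the left and the projections from the right, so
    the two actions do not interfere. Measuring [E] by the Frobenius norm of [S *m E] lets the
    weight [S] adapt to [A] while the right factor is still bounded by the operator norm [delta]; a
    condition number paid in every cycle would destroy the strict margin.

    The gain meets a different obstacle: the dwell time is fixed, so the overshoot of the injection
    must lose against [expR (- g * tau)], which is why polynomial conditioning matters. The
    overshoot that remains inside an interval ([K]) enters only the final constant, never the cycle
    factor, because cycles are chained at switching instants. The tolerance [eps] and a coercivity
    constant common to all visited graphs are fixed before [L]. *)

Definition fdot (R : pzRingType) (a b : nat) (X Y : 'M[R]_(a, b)) : R :=
  \tr (X^T *m Y).

Definition fsq (R : pzRingType) (a b : nat) (X : 'M[R]_(a, b)) : R := fdot X X.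

Section Frobenius.
Variable R : realFieldType.
Implicit Types a b c : nat.

Lemma fdotE a b (X Y : 'M[R]_(a, b)) :
  fdot X Y = \sum_(i < a) \sum_(j < b) X i j * Y i j.
Proof.
rewrite /fdot /mxtrace exchange_big; apply: eq_bigr => j _.
by rewrite mxE; apply: eq_bigr => i _; rewrite mxE.
Qed.

Lemma fdotC a b (X Y : 'M[R]_(a, b)) : fdot X Y = fdot Y X.
Proof. by rewrite /fdot -mxtrace_tr trmx_mul trmxK. Qed.

Lemma fdotDl a b (X Y Z : 'M[R]_(a, b)) : fdot (X + Y) Z = fdot X Z + fdot Y Z.
Proof. by rewrite /fdot linearD mulmxDl linearD. Qed.

Lemma fdotDr a b (X Y Z : 'M[R]_(a, b)) : fdot X (Y + Z) = fdot X Y + fdot X Z.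
Proof. by rewrite /fdot mulmxDr linearD. Qed.

Lemma fdotNl a b (X Y : 'M[R]_(a, b)) : fdot (- X) Y = - fdot X Y.
Proof. by rewrite /fdot linearN mulNmx linearN. Qed.

Lemma fdotNr a b (X Y : 'M[R]_(a, b)) : fdot X (- Y) = - fdot X Y.
Proof. by rewrite /fdot mulmxN linearN. Qed.

Lemma fdotZl a b (k : R) (X Y : 'M[R]_(a, b)) : fdot (k *: X) Y = k * fdot X Y.
Proof. by rewrite /fdot linearZ -scalemxAl linearZ. Qed.

Lemma fdotZr a b (k : R) (X Y : 'M[R]_(a, b)) : fdot X (k *: Y) = k * fdot X Y.
Proof. by rewrite /fdot -scalemxAr linearZ. Qed.

Lemma fdot_suml a b (I : Type) (r : seq I) (F : I -> 'M[R]_(a, b)) Y :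
  fdot (\sum_(i <- r) F i) Y = \sum_(i <- r) fdot (F i) Y.
Proof. by rewrite /fdot raddf_sum /= mulmx_suml raddf_sum. Qed.

Lemma fdot_sumr a b (I : Type) (r : seq I) (F : I -> 'M[R]_(a, b)) X :
  fdot X (\sum_(i <- r) F i) = \sum_(i <- r) fdot X (F i).
Proof. by rewrite fdotC fdot_suml; apply: eq_bigr => i _; rewrite fdotC. Qed.

Lemma fdot_mull a b c (A : 'M[R]_(c, a)) (X : 'M[R]_(a, b)) Y :
  fdot (A *m X) Y = fdot X (A^T *m Y).
Proof. by rewrite /fdot trmx_mul mulmxA. Qed.

Lemma fdot_mulr a b c (X : 'M[R]_(a, b)) (B : 'M[R]_(b, c)) Y :
  fdot (X *m B) Y = fdot X (Y *m B^T).
Proof. by rewrite /fdot trmx_mul -mulmxA mxtrace_mulC mulmxA. Qed.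

Lemma fsqE a b (X : 'M[R]_(a, b)) : fsq X = \sum_i \sum_j X i j ^+ 2.
Proof. by rewrite /fsq fdotE; do 2!apply: eq_bigr => ? _. Qed.

Lemma fsq_ge0 a b (X : 'M[R]_(a, b)) : 0 <= fsq X.
Proof. by rewrite fsqE; do 2!apply: sumr_ge0 => ? _; rewrite sqr_ge0. Qed.

Lemma entry_le_fsq a b (X : 'M[R]_(a, b)) i j : X i j ^+ 2 <= fsq X.
Proof.
rewrite fsqE (bigD1 i) //= (bigD1 j) //= -addrA lerDl addr_ge0 //.
  by apply: sumr_ge0 => ? _; rewrite sqr_ge0.
by do 2!apply: sumr_ge0 => ? _; rewrite sqr_ge0.
Qed.

Lemma fsq_le0 a b (X : 'M[R]_(a, b)) : fsq X <= 0 -> X = 0.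
Proof.
move=> X0; apply/matrixP => i j; rewrite mxE; apply/eqP.
by rewrite -sqrf_eq0 eq_le sqr_ge0 (le_trans (entry_le_fsq X i j)).
Qed.

Lemma fsq0 a b : fsq (0 : 'M[R]_(a, b)) = 0.
Proof. by rewrite fsqE big1 // => i _; rewrite big1 // => j _; rewrite mxE expr0n. Qed.

Lemma fsqN a b (X : 'M[R]_(a, b)) : fsq (- X) = fsq X.
Proof. by rewrite /fsq fdotNl fdotNr opprK. Qed.

Lemma fsqZ a b k (X : 'M[R]_(a, b)) : fsq (k *: X) = k ^+ 2 * fsq X.
Proof. by rewrite /fsq fdotZl fdotZr mulrA. Qed.

Lemma fsqD a b (X Y : 'M[R]_(a, b)) : fsq (X + Y) = fsq X + 2 * fdot X Y + fsq Y.
Proof. by rewrite /fsq !fdotDl !fdotDr (fdotC Y X); ring. Qed.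

Lemma fsqB a b (X Y : 'M[R]_(a, b)) : fsq (X - Y) = fsq X - 2 * fdot X Y + fsq Y.
Proof. by rewrite fsqD fsqN fdotNr; ring. Qed.

Lemma fsqD_le a b (X Y : 'M[R]_(a, b)) : fsq (X + Y) <= 2 * fsq X + 2 * fsq Y.
Proof. by have := fsq_ge0 (X - Y); rewrite fsqB fsqD; lra. Qed.

Lemma fsqB_le a b (X Y : 'M[R]_(a, b)) : fsq (X - Y) <= 2 * fsq X + 2 * fsq Y.
Proof. by rewrite -(fsqN Y) fsqD_le. Qed.

Lemma fsq_sum_le a b k (F : 'I_k -> 'M[R]_(a, b)) :
  fsq (\sum_i F i) <= 2 ^+ k * \sum_i fsq (F i).
Proof.
elim: k F => [|k IH] F; first by rewrite !big_ord0 fsq0 mulr0.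
rewrite !big_ord_recl exprS (le_trans (fsqD_le _ _)) // -mulrDr -mulrA ler_pM2l //.
rewrite mulrDr lerD //.
by rewrite ler_peMl ?fsq_ge0 // exprn_ege1 // ler1n.
Qed.

Lemma fdot_CS a b (X Y : 'M[R]_(a, b)) : fdot X Y ^+ 2 <= fsq X * fsq Y.
Proof.
have := fsq_ge0 X; rewrite le_eqVlt => /predU1P[/esym X0|X0].
  have -> : X = 0 by apply: fsq_le0; rewrite X0.
  by rewrite fsq0 mul0r /fdot trmx0 mul0mx mxtrace0 expr0n.
have := fsq_ge0 (fsq X *: Y - fdot X Y *: X).
rewrite fsqB !fsqZ fdotZl fdotZr (fdotC Y X).
have -> : fsq X ^+ 2 * fsq Y - 2 * (fsq X * (fdot X Y * fdot X Y)) +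
  fdot X Y ^+ 2 * fsq X = fsq X * (fsq X * fsq Y - fdot X Y ^+ 2) by ring.
by rewrite pmulr_rge0 // subr_ge0.
Qed.

Lemma fsq_rows a b (X : 'M[R]_(a, b)) : fsq X = \sum_i fsq (row i X)^T.
Proof.
rewrite fsqE; apply: eq_bigr => i _; rewrite fsqE; apply: eq_bigr => j _.
by rewrite big_ord1 !mxE.
Qed.

Lemma fdot_cols a b (X Y : 'M[R]_(a, b)) :
  fdot X Y = \sum_j fdot (col j X) (col j Y).
Proof.
rewrite fdotE exchange_big; apply: eq_bigr => i _; rewrite fdotE.
by apply: eq_bigr => j _; rewrite big_ord1 !mxE.
Qed.

Lemma fsqM a b c (A : 'M[R]_(a, b)) (X : 'M[R]_(b, c)) :
  fsq (A *m X) <= fsq A * fsq X.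
Proof.
rewrite [fsq X]fdot_cols (fsq_rows A) mulr_suml fsqE.
apply: ler_sum => i _; rewrite mulr_sumr; apply: ler_sum => j _.
apply: le_trans (fdot_CS _ _).
have -> : fdot (row i A)^T (col j X) = (A *m X) i j.
  by rewrite fdotE mxE; apply: eq_bigr => k _; rewrite big_ord1 !mxE.
exact: lexx.
Qed.

Lemma fsq_expM_le a b (B : 'M[R]_a) (X : 'M[R]_(a, b)) (k : R) j : 0 <= k ->
  (forall Y : 'M[R]_(a, b), fsq (B *m Y) <= k * fsq Y) ->
  fsq (B ^+ j *m X) <= k ^+ j * fsq X.
Proof.
move=> k0 Bk; elim: j => [|j IH]; first by rewrite !expr0 mul1mx mul1r.
by rewrite !exprS -mulmxE -mulmxA (le_trans (Bk _)) // -mulrA ler_wpM2l.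
Qed.

Lemma fsq_proj a b (X : 'M[R]_(a, b)) (P : 'M[R]_b) : P^T = P -> P *m P = P ->
  fsq X = fsq (X *m P) + fsq (X *m (1%:M - P)).
Proof.
move=> Ps PP; rewrite -{1}[X](subrK (X *m P)) -{1}[X]mulmx1 -mulmxBr fsqD.
have -> : fdot (X *m (1%:M - P)) (X *m P) = 0; last by rewrite mulr0 addr0 addrC.
rewrite fdotC fdot_mulr Ps -mulmxA mulmxBl mul1mx PP subrr.
by rewrite mulmx0 /fdot mulmx0 mxtrace0.
Qed.

Lemma fsq_proj_le a b (X : 'M[R]_(a, b)) (P : 'M[R]_b) :
  P^T = P -> P *m P = P -> fsq (X *m P) <= fsq X.
Proof. by move=> Ps PP; rewrite (fsq_proj X Ps PP) lerDl fsq_ge0. Qed.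

End Frobenius.

Definition fnorm (R : rcfType) (a b : nat) (X : 'M[R]_(a, b)) : R :=
  Num.sqrt (fsq X).

Section FrobeniusNorm.
Variable R : rcfType.
Implicit Types a b : nat.

Lemma fnorm_ge0 a b (X : 'M[R]_(a, b)) : 0 <= fnorm X.
Proof. exact: sqrtr_ge0. Qed.

Lemma sqr_fnorm a b (X : 'M[R]_(a, b)) : fnorm X ^+ 2 = fsq X.
Proof. by rewrite sqr_sqrtr ?fsq_ge0. Qed.

Lemma fnormD a b (X Y : 'M[R]_(a, b)) : fnorm (X + Y) <= fnorm X + fnorm Y.
Proof.
rewrite -(@ler_pXn2r _ 2) ?nnegrE ?addr_ge0 ?fnorm_ge0 //.
rewrite sqrrD !sqr_fnorm fsqD lerD2r lerD2l -[leRHS]mulr_natl ler_pM2l //.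
rewrite (le_trans (ler_norm _)) // -sqrtr_sqr /fnorm -sqrtrM ?fsq_ge0 //.
by rewrite ler_wsqrtr // fdot_CS.
Qed.

Lemma fnorm_le a b c d (k : R) (X : 'M[R]_(a, b)) (Y : 'M[R]_(c, d)) : 0 <= k ->
  fsq X <= k ^+ 2 * fsq Y -> fnorm X <= k * fnorm Y.
Proof.
move=> k0 h; rewrite -(@ler_pXn2r _ 2) ?nnegrE ?mulr_ge0 ?fnorm_ge0 //.
by rewrite exprMn !sqr_fnorm.
Qed.

Lemma enorm_fnorm a (v : 'cV[R]_a) : enorm v = fnorm v.
Proof.
rewrite /enorm /fnorm fsqE; congr Num.sqrt; apply: eq_bigr => i _.
by rewrite big_ord1.
Qed.

End FrobeniusNorm.

(** * Adapted Euclidean norms *)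

Lemma finite_lt_uniform (R : realFieldType) (I : finType) (f : I -> R) (c : R) :
  (forall i, f i < c) -> exists2 m, m < c & forall i, f i <= m.
Proof.
move=> fc; exists (\big[Num.max/c - 1]_i f i); last by move=> i; exact: le_bigmax.
by apply/bigmax_ltP; split => //; rewrite ltrBlDr ltrDl.
Qed.

(* Gershgorin-type estimate: the left-hand side is the real part of
   [tr ((u + i v)^* (M + i M') (u + i v))]. *)
Lemma near_diag_le (R : realFieldType) (n b : nat) (M M' : 'M[R]_n)
    (u v : 'M[R]_(n, b)) (m h : R) : 0 <= h ->
  (forall i, M i i <= m) ->
  (forall i j, i != j -> `|M i j| <= h /\ `|M' i j| <= h) ->
  fdot (M *m u - M' *m v) u + fdot (M *m v + M' *m u) v
    <= (m + 2 * n%:R * h) * (fsq u + fsq v).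
Proof.
move=> h0 Mm Mh.
pose s (i : 'I_n) k := u i k ^+ 2 + v i k ^+ 2.
have s0 i k : 0 <= s i k by rewrite addr_ge0 ?sqr_ge0.
(* The bound is spread over all index pairs so that both sides can be compared term by term. *)
have sumE (f : 'I_n -> R) : \sum_i \sum_j (h * (f i + f j) + m *+ (i == j) * f i) =
    (m + 2 * n%:R * h) * \sum_i f i.
  under eq_bigr => i _ do rewrite big_split /=.
  rewrite big_split /= addrC mulrDl; congr (_ + _).
    rewrite mulr_sumr; apply: eq_bigr => i _.
    rewrite (bigD1 i) //= eqxx mulr1n big1 ?addr0 // => j ji.
    by rewrite eq_sym (negPf ji) mulr0n mul0r.
  under eq_bigr => i _ do rewrite -mulr_sumr big_split /= sumr_const card_ord.
  rewrite -mulr_sumr big_split /= sumrMnl sumr_const card_ord -[_ *+ n]mulr_natl.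
  by ring.
have -> : (m + 2 * n%:R * h) * (fsq u + fsq v) =
    \sum_(k < b) \sum_(i < n) \sum_(j < n) (h * (s i k + s j k) + m *+ (i == j) * s i k).
  have -> : fsq u + fsq v = \sum_(k < b) \sum_(i < n) s i k.
    by rewrite exchange_big !fsqE -big_split; apply: eq_bigr => i _; rewrite -big_split.
  by rewrite mulr_sumr; apply: eq_bigr => k _; rewrite (sumE (s^~ k)).
have -> : fdot (M *m u - M' *m v) u + fdot (M *m v + M' *m u) v =
    \sum_(k < b) \sum_(i < n) \sum_(j < n) (M i j * (u j k * u i k + v j k * v i k)
        + M' i j * (u j k * v i k - v j k * u i k)).
  rewrite exchange_big !fdotE -big_split; apply: eq_bigr => i _ /=.
  rewrite -big_split; apply: eq_bigr => k _ /=; rewrite !mxE.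
  rewrite mulrBl mulrDl !mulr_suml -sumrB -!big_split /=.
  by apply: eq_bigr => j _; ring.
apply: ler_sum => k _; apply: ler_sum => i _; apply: ler_sum => j _.
(* On the diagonal the [M'] terms cancel, so the imaginary parts of the eigenvalues cost nothing;
   off it, each product is at most the mean of the squares. *)
have [<-|ij] := eqVneq i j.
  rewrite mulr1n /s; have := Mm i; have := s0 i k; rewrite /s => s0' Mi.
  have := mulr_ge0 h0 s0'.
  have : M i i * (u i k ^+ 2 + v i k ^+ 2) <= m * (u i k ^+ 2 + v i k ^+ 2).
    by rewrite ler_wpM2r.
  lra.
rewrite mulr0n mul0r addr0; rewrite /s.
have n1 (x y : R) : `|x * y| <= (x ^+ 2 + y ^+ 2) / 2.
  have := sqr_ge0 (x + y); have := sqr_ge0 (x - y).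
  by rewrite ler_norml => ? ?; apply/andP; split; lra.
have bd (e p q t1 t2 t3 t4 : R) : `|e| <= h -> `|p| <= (t1 + t2) / 2 ->
    `|q| <= (t3 + t4) / 2 -> e * (p + q) <= h * ((t1 + t2) / 2 + (t3 + t4) / 2).
  move=> eh pt qt; rewrite (le_trans (ler_norm _)) // normrM ler_pM //.
  by rewrite (le_trans (ler_normD _ _)) // lerD.
have [hM hM'] := Mh i j ij.
have := bd _ _ _ _ _ _ _ hM (n1 (u j k) (u i k)) (n1 (v j k) (v i k)).
have := bd _ _ _ _ _ _ _ hM' (n1 (u j k) (v i k)) (n1 (- v j k) (u i k)).
rewrite !sqrrN mulNr; lra.
Qed.

Lemma Re_mulmx (R : rcfType) a b c (X : 'M[R[i]]_(a, b)) (Y : 'M[R[i]]_(b, c)) :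
  map_mx (@complex.Re R) (X *m Y) =
  map_mx (@complex.Re R) X *m map_mx (@complex.Re R) Y
  - map_mx (@complex.Im R) X *m map_mx (@complex.Im R) Y.
Proof.
apply/matrixP => i j; rewrite !mxE raddf_sum -sumrB; apply: eq_bigr => k _ /=.
by rewrite !mxE; case: (X i k); case: (Y k j).
Qed.

Lemma Im_mulmx (R : rcfType) a b c (X : 'M[R[i]]_(a, b)) (Y : 'M[R[i]]_(b, c)) :
  map_mx (@complex.Im R) (X *m Y) =
  map_mx (@complex.Re R) X *m map_mx (@complex.Im R) Y
  + map_mx (@complex.Im R) X *m map_mx (@complex.Re R) Y.
Proof.
apply/matrixP => i j; rewrite !mxE raddf_sum -big_split; apply: eq_bigr => k _ /=.
by rewrite !mxE; case: (X i k); case: (Y k j).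
Qed.

(** Schur triangularisation. A diagonal entry is an eigenvalue of the triangular matrix, and a left
    eigenvector [v] for it yields the left eigenvector [v *m P] of [A]. *)
Lemma complex_triangular_form (R : rcfType) n (A : 'M[R]_n) (c : R) :
  (0 < n)%N -> lambda_max_lt A c ->
  exists P T : 'M[R[i]]_n, [/\ P \in unitmx,
    P *m map_mx (real_complex R) A = T *m P, is_trig_mx T &
    forall i, complex.Re (T i i) < c].
Proof.
move=> n0 Ac; set B := map_mx _ A.
have [P Pu] := @spectral.Schur _ n B n0.
rewrite /simmx_to_for => Ttrig; exists P, (conjmx P B).
have Pun := spectral.unitarymx_unit Pu.
have PB : P *m B = conjmx P B *m P by apply/simmxP => //; exact: eqxx.
split => // i; apply: Ac.
rewrite /eigenvalueC map_char_poly -eigenvalue_root_char.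
have : eigenvalue (conjmx P B) (conjmx P B i i).
  rewrite eigenvalue_root_char char_poly_trig //.
  by rewrite (bigD1 i) //= rootM root_XsubC eqxx.
move=> /eigenvalueP[v vT v0]; apply/eigenvalueP; exists (v *m P).
  by rewrite -mulmxA PB mulmxA vT scalemxAl.
by apply: contraNneq v0 => vP; rewrite -(mulmxK Pun v) vP mul0mx.
Qed.

(** Conjugating the lower triangular form by the diagonal matrix of the [d ^+ i] multiplies entry
    [(i, j)] with [j < i] by at most [d], so the off-diagonal part becomes small while the diagonal
    stays. The complex coordinates are stored as stacked real and imaginary parts, hence the [n + n]
    rows of [S] and a left inverse [G] only. *)
Lemma adapted_norm (R : rcfType) n (A : 'M[R]_n) (c : R) :
  lambda_max_lt A c ->
  exists beta, beta < c /\
  exists (S : 'M[R]_(n + n, n)) (G : 'M[R]_(n, n + n)), G *m S = 1%:M /\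
  forall b (X : 'M[R]_(n, b)), fdot (S *m (A *m X)) (S *m X) <= beta * fsq (S *m X).
Proof.
case: (posnP n) => [n0|n0] Ac.
  exists (c - 1); split; first by rewrite ltrBlDr ltrDl.
  exists 0, 0; split; first by apply/matrixP => i; have := ltn_ord i; rewrite {2}n0.
  by move=> b X; rewrite !mul0mx fsq0 mulr0 /fdot mulmx0 mxtrace0.
have [P [T [Pu PA Ttrig Tc]]] := complex_triangular_form n0 Ac.
have [m mc Tm] := finite_lt_uniform Tc.
pose Pr := map_mx (@complex.Re R) P; pose Pi := map_mx (@complex.Im R) P.
pose Tr := map_mx (@complex.Re R) T; pose Ti := map_mx (@complex.Im R) T.
have ReA : map_mx (@complex.Re R) (map_mx (real_complex R) A) = A.
  by apply/matrixP => i j; rewrite !mxE.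
have ImA : map_mx (@complex.Im R) (map_mx (real_complex R) A) = 0.
  by apply/matrixP => i j; rewrite !mxE.
have PrA : Pr *m A = Tr *m Pr - Ti *m Pi.
  by rewrite -Re_mulmx -PA Re_mulmx ReA ImA mulmx0 subr0.
have PiA : Pi *m A = Tr *m Pi + Ti *m Pr.
  by rewrite -Im_mulmx -PA Im_mulmx ReA ImA mulmx0 add0r.
(* [m] bounds the real parts of the diagonal; this [h] keeps [m + 2 * n%:R * h] strictly below
   [c]. *)
pose h := (c - m) / (4 * n%:R + 1).
have n4 : 0 < 4 * n%:R + 1 :> R by rewrite ltr_wpDl // mulr_ge0.
have h0 : 0 < h by rewrite divr_gt0 // subr_gt0.
pose K := 1 + \sum_i \sum_j (`|Tr i j| + `|Ti i j|).
have TK i j : `|Tr i j| + `|Ti i j| <= K.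
  have F0 k l : 0 <= `|Tr k l| + `|Ti k l| by exact: addr_ge0.
  have S0 (B : pred 'I_n) k : 0 <= \sum_(l | B l) (`|Tr k l| + `|Ti k l|).
    by apply: sumr_ge0 => *; exact: F0.
  rewrite /K (bigD1 i) //= (bigD1 j) //=; have S1 := S0 (predC1 j) i.
  have : 0 <= \sum_(k | k != i) \sum_l (`|Tr k l| + `|Ti k l|).
    by apply: sumr_ge0 => *; exact: S0.
  rewrite /= in S1 *; lra.
have K0 : 0 < K.
  rewrite ltr_pwDl // sumr_ge0 // => i _; rewrite sumr_ge0 // => j _; exact: addr_ge0.
pose d := Num.min 1 (h / K).
have d0 : 0 < d by rewrite lt_min ltr01 divr_gt0.
have d1 : d <= 1 by rewrite ge_min lexx.
have dK : d * K <= h by rewrite -ler_pdivlMr // ge_min lexx orbT.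
pose D : 'M[R]_n := diag_mx (\row_i d ^+ i); pose D' : 'M[R]_n := diag_mx (\row_i (d ^+ i)^-1).
have D'D : D' *m D = 1%:M.
  apply/matrixP => i j; rewrite mul_diag_mx !mxE; have [->|] := eqVneq i j.
    by rewrite !mulr1n mulVf // expf_neq0 // gt_eqF.
  by rewrite !mulr0n mulr0.
have DTD (M : 'M[R]_n) i j : (D *m M *m D') i j = d ^+ i / d ^+ j * M i j.
  by rewrite mul_mx_diag mul_diag_mx !mxE mulrAC.
exists (m + 2 * n%:R * h : R); split.
  have : (4 * n%:R + 1) * h = c - m by rewrite mulrC divfK // gt_eqF.
  have : 0 <= n%:R * h by rewrite mulr_ge0 // ltW.
  lra.
pose Q := invmx P.
exists (col_mx (D *m Pr) (D *m Pi)).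
exists (row_mx (map_mx (@complex.Re R) Q *m D') (- (map_mx (@complex.Im R) Q *m D'))).
split.
  rewrite mul_row_col mulNmx -!mulmxA !(mulmxA D') D'D !mul1mx -Re_mulmx mulVmx //.
  by apply/matrixP => i j; rewrite !mxE; case: (i == j).
move=> b X.
have fdot_col (U V U' V' : 'M[R]_(n, b)) :
    fdot (col_mx U V) (col_mx U' V') = fdot U U' + fdot V V'.
  by rewrite /fdot tr_col_mx mul_row_col linearD.
rewrite /fsq !mul_col_mx !fdot_col -!/(fsq _).
pose u := D *m Pr *m X; pose v := D *m Pi *m X.
have uA : D *m Pr *m (A *m X) = (D *m Tr *m D') *m u - (D *m Ti *m D') *m v.
  rewrite /u /v -!mulmxA !(mulmxA D') D'D !mul1mx !mulmxA -(mulmxA D Pr) PrA.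
  by rewrite mulmxBr mulmxBl !mulmxA.
have vA : D *m Pi *m (A *m X) = (D *m Tr *m D') *m v + (D *m Ti *m D') *m u.
  rewrite /u /v -!mulmxA !(mulmxA D') D'D !mul1mx !mulmxA -(mulmxA D Pi) PiA.
  by rewrite mulmxDr mulmxDl !mulmxA.
rewrite uA vA; apply: near_diag_le; first exact: ltW.
  by move=> i; rewrite DTD divff ?mul1r ?expf_neq0 ?gt_eqF // mxE.
move=> i j ij; rewrite !DTD.
have [lij|lji] := ltnP i j.
  have T0 : T i j = 0 by move/is_trig_mxP: Ttrig; apply.
  by rewrite !mxE T0 /= !mulr0 normr0 ltW.
have {}lji : (j < i)%N by rewrite ltn_neqAle lji andbT eq_sym.
have dd : `|d ^+ i / d ^+ j| <= d.
  rewrite -expfB // ger0_norm ?exprn_ge0 ?(ltW d0) // -(subnSK lji) exprS.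
  by rewrite ler_piMr ?exprn_ile1 ?(ltW d0).
have [hr hi] : `|Tr i j| <= K /\ `|Ti i j| <= K.
  by split; apply: le_trans (TK i j); rewrite ?lerDl ?lerDr.
by split; apply: le_trans dK; rewrite (normrM (d ^+ i / d ^+ j)); apply: ler_pM.
Qed.

(** * High-gain Lyapunov forms *)

Lemma observable_left_inverse (R : fieldType) n m (C : 'M[R]_(m, n)) (A : 'M[R]_n) :
  observable C A ->
  exists F : 'I_n -> 'M[R]_(n, m), \sum_k F k *m (C *m A ^+ k) = 1%:M.
Proof.
move=> obs; have /row_fullP[B BO] : row_full (\mxcol_(k < n) (C *m A ^+ k)).
  by rewrite /row_full obs.
by exists (submxrow B); rewrite -mul_mxrow_mxcol submxrowK.
Qed.

(** Telescoping: if [s] is the partial sum ending with [r k], then [fsq s] exceeds the previous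
    square by [2 * fdot s (r k) - fsq (r k)]. This yields the decay terms of the Lyapunov form
    below. *)
Lemma fdot_partial_sums (R : realFieldType) a b K (r : nat -> 'M[R]_(a, b)) :
  2 * \sum_(k < K) fdot (\sum_(l < k.+1) r l) (r k) =
  fsq (\sum_(l < K) r l) + \sum_(k < K) fsq (r k).
Proof.
elim: K => [|K IH]; first by rewrite !big_ord0 fsq0 mulr0 addr0.
rewrite big_ord_recr [in RHS]big_ord_recr [\sum_(k < K.+1) fsq _]big_ord_recr /=.
by rewrite mulrDr IH fsqD big_ord_recr fdotDl /= -/(fsq (r K)); ring.
Qed.

Lemma unitmx_mulmx_inj (R : realFieldType) n (B : 'M[R]_n) :
  (forall v : 'cV[R]_n, B *m v = 0 -> v = 0) -> B \in unitmx.
Proof.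
move=> Binj; rewrite -unitmx_tr -row_free_unit -kermx_eq0; apply/eqP/row_matrixP => i.
rewrite row0 -[LHS]trmxK (Binj (row i (kermx B^T))^T) ?trmx0 //.
rewrite -[LHS]trmxK trmx_mul trmxK -row_mul mulmx_ker row0 trmx0 //.
Qed.

(* With [M = (g + A)^-1] and [D_k = C (A M)^k M] (the Laguerre transforms of the
   output) one has [D_k A = C - g (D_0 + ... + D_k)]; hence
   [V X = sum_k |D_k X|^2] decays at rate [g] along [X' = A X], up to the
   injection of [C X].  The point is that the lower bound on [V] degrades only
   polynomially in [g]. *)
Lemma observer_form (R : realFieldType) n m (C : 'M[R]_(m, n)) (A : 'M[R]_n) :
  observable C A ->
  exists g0 c1 c2 : R, [/\ 0 < g0, 0 <= c1, 0 <= c2 & forall g, g0 <= g ->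
  exists Q : 'M[R]_n, Q^T = Q /\ forall b (X : 'M[R]_(n, b)),
  [/\ 0 <= fdot X (Q *m X), fdot X (Q *m X) <= c1 * fsq X,
      fsq X <= c2 * (2 * g ^+ 2 + 2 * fsq A) ^+ n * fdot X (Q *m X) &
      2 * fdot (A *m X) (Q *m X) <= - g * fdot X (Q *m X) + g^-1 * fsq (C *m X)]].
Proof.
move=> /observable_left_inverse[F FCA].
have A0 := fsq_ge0 A.
(* Beyond this threshold [g%:M + A] does not contract, so its inverse [M] does not expand; [c1] sums
   the resulting bounds on the [D k], and [c2] is the cost of recovering a vector from its
   outputs. *)
exists (2 * fsq A + 2), (\sum_(k < n) fsq C * fsq A ^+ k).
exists (2 ^+ n * \sum_k fsq (F k) * 4 ^+ n); split.
- lra.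
- by apply: sumr_ge0 => k _; rewrite mulr_ge0 ?exprn_ge0 ?fsq_ge0.
- by rewrite mulr_ge0 ?exprn_ge0 // sumr_ge0 // => k _; rewrite mulr_ge0 ?exprn_ge0 ?fsq_ge0.
move=> g gg0; have g1 : 1 <= g by lra.
have g_gt0 : 0 < g by lra.
pose B := g%:M + A.
have lowB b (Z : 'M[R]_(n, b)) : fsq Z <= fsq (B *m Z).
  have := fsqM A Z; have := fsqB_le (B *m Z) (A *m Z); have := fsq_ge0 Z.
  have -> : B *m Z - A *m Z = g *: Z by rewrite mulmxDl addrK mul_scalar_mx.
  rewrite fsqZ => Z0 h1 h2; have : (2 * fsq A + 2) * fsq Z <= g ^+ 2 * fsq Z.
    by rewrite ler_wpM2r // (le_trans gg0) // expr2 ler_peMl // ltW.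
  lra.
have Bu : B \in unitmx.
  by apply: unitmx_mulmx_inj => v Bv; apply: fsq_le0; rewrite (le_trans (lowB _ _)) // Bv fsq0.
pose M := invmx B.
have MB : M * B = 1 by exact: mulVmx.
have BM : B * M = 1 by exact: mulmxV.
have AB : GRing.comm A B.
  by rewrite /B; apply: commrD => //; exact: scalar_mxC.
have AM : GRing.comm A M.
  by rewrite /GRing.comm -[LHS]mul1r -{1}MB -!mulrA (mulrA B) -AB -!mulrA BM mulr1.
pose q := A * M.
have qE : g *: M = 1 - q.
  by rewrite /q -BM /B mulrDl addrK -mulmxE mul_scalar_mx.
have qM : GRing.comm q M by rewrite /GRing.comm /q [RHS]mulrA -AM.
have qA : GRing.comm q A by rewrite /GRing.comm /q -mulrA -AM.
have fsqMZ b (Z : 'M[R]_(n, b)) : fsq (M *m Z) <= 1 * fsq Z.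
  by rewrite mul1r (le_trans (lowB _ _)) // mulmxA mulmxE BM mul1mx.
have fsqq b (Z : 'M[R]_(n, b)) : fsq (q *m Z) <= fsq A * fsq Z.
  rewrite /q -mulmxE -mulmxA (le_trans (fsqM _ _)) // ler_wpM2l //.
  by rewrite (le_trans (fsqMZ _ _)) ?mul1r.
pose D k := C *m (q ^+ k * M).
have DA k : D k *m A = C - g *: \sum_(l < k.+1) D l.
  have DAq j : D j *m A = C *m q ^+ j.+1.
    by rewrite /D -mulmxA mulmxE -mulrA -AM exprSr.
  elim: k => [|k IH].
    rewrite big_ord1 DAq expr1 /D expr0 mul1r scalemxAr qE mulmxBr (mulmx1 C). 
    by rewrite opprB addrC subrK.
  rewrite DAq big_ord_recr scalerDr opprD addrA -IH DAq /= /D scalemxAr.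
  have -> : g *: (q ^+ k.+1 * M) = q ^+ k.+1 * (1 - q) by rewrite -qE -!mulmxE scalemxAr.
  by rewrite mulrBr mulr1 mulmxBr opprB addrC subrK -exprSr.
pose Q := \sum_(k < n) (D k)^T *m D k.
have QE b (Y X : 'M[R]_(n, b)) : fdot Y (Q *m X) = \sum_(k < n) fdot (D k *m Y) (D k *m X).
  rewrite /Q mulmx_suml fdot_sumr; apply: eq_bigr => k _.
  by rewrite [RHS]fdot_mull mulmxA.
have QEs b (X : 'M[R]_(n, b)) : fdot X (Q *m X) = \sum_(k < n) fsq (D k *m X).
  exact: QE.
exists Q; split.
  by rewrite /Q raddf_sum; apply: eq_bigr => k _ /=; rewrite trmx_mul trmxK.
move=> b X; rewrite QEs; set V := \sum_(k < n) _.
have V0 : 0 <= V by apply: sumr_ge0 => k _; exact: fsq_ge0.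
split => //.
- rewrite mulr_suml; apply: ler_sum => k _.
  rewrite /D -mulmxA (le_trans (fsqM _ _)) // -mulrA ler_wpM2l ?fsq_ge0 //.
  rewrite -mulmxE -mulmxA (le_trans (fsq_expM_le _ _ A0 (fsqq b))) //.
  by rewrite ler_wpM2l ?exprn_ge0 // (le_trans (fsqMZ _ _)) ?mul1r.
(* Powers of [1 - q] are unfolded one factor at a time into a difference of two terms already
   bounded, each time at the price of a factor [4]. *)
- have low i : forall j, (j + i < n)%N ->
      fsq (C *m (q ^+ j * (1 - q) ^+ i * M) *m X) <= 4 ^+ i * V.
    elim: i => [|i IH] j jn.
      rewrite addn0 in jn; rewrite expr0 mulr1 mul1r /V (bigD1 (Ordinal jn)) //= lerDl.
      by apply: sumr_ge0 => k _; exact: fsq_ge0.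
    have -> : q ^+ j * (1 - q) ^+ i.+1 * M =
        q ^+ j * (1 - q) ^+ i * M - q ^+ j.+1 * (1 - q) ^+ i * M.
      rewrite exprS mulrA mulrBr mulr1 -exprSr !mulrBl; congr (_ - _).
    rewrite mulmxBr mulmxBl (le_trans (fsqB_le _ _)) //.
    have h1 : fsq (C *m (q ^+ j * (1 - q) ^+ i * M) *m X) <= 4 ^+ i * V by apply: IH; lia.
    have h2 : fsq (C *m (q ^+ j.+1 * (1 - q) ^+ i * M) *m X) <= 4 ^+ i * V by apply: IH; lia.
    by rewrite [4 ^+ _]exprS; lra.
  (* [A ^+ j * M ^+ n] is [q ^+ j] times [n - j] factors [M]; by [qE] all of these but one become
     [1 - q], up to [g ^- i], which is at most [1]. *)
  have CAM (j : 'I_n) : fsq (C *m A ^+ j *m (M ^+ n *m X)) <= 4 ^+ n * V.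
    pose i := (n - j.+1)%N; have ji : (j + i < n)%N by rewrite /i; have := ltn_ord j; lia.
    have nE : n = (j + i).+1 by rewrite /i; have := ltn_ord j; lia.
    have -> : fsq (C *m A ^+ j *m (M ^+ n *m X)) =
        (g ^- i) ^+ 2 * fsq (C *m (q ^+ j * (1 - q) ^+ i * M) *m X).
      have -> : (1 - q) ^+ i = g ^+ i *: M ^+ i.
        rewrite -qE; elim: {ji nE} i => [|i IH]; first by rewrite !expr0 scale1r.
        by rewrite !exprS IH -!mulmxE -scalemxAl -scalemxAr scalerA.
      rewrite -fsqZ; congr fsq; rewrite -!mulmxE -scalemxAr -scalemxAl -scalemxAr -scalemxAl.
      rewrite scalerA mulVf ?scale1r ?mulmxE.
        have -> : M ^+ n = M ^+ j * M ^+ i * M by rewrite -exprD -exprSr -nE.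
        by rewrite exprMn_comm // -!mulmxE -!mulmxA.
      by rewrite expf_neq0 // gt_eqF.
    apply: (@le_trans _ _ (1 * (4 ^+ i * V))).
      apply: ler_pM; rewrite ?sqr_ge0 ?fsq_ge0 ?low //.
      by rewrite exprn_ile1 // ?invr_ge0 ?invf_le1 ?exprn_gt0 ?exprn_ege1 // exprn_ge0 // ltW.
    by rewrite mul1r ler_wpM2r // ler_weXn2l ?ler1n //; lia.
  (* Only these [n] factors [B] grow with [g]: this is the polynomial loss in the lower bound. *)
  have BMn : X = B ^+ n *m (M ^+ n *m X).
    rewrite mulmxA mulmxE -exprMn_comm ?BM ?expr1n ?mul1mx //.
    by rewrite /GRing.comm BM MB.
  have fB b' (Y : 'M[R]_(n, b')) : fsq (B *m Y) <= (2 * g ^+ 2 + 2 * fsq A) * fsq Y.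
    rewrite mulmxDl (le_trans (fsqD_le _ _)) // mul_scalar_mx fsqZ.
    by have := fsqM A Y; lra.
  have gA0 : 0 <= 2 * g ^+ 2 + 2 * fsq A by have := sqr_ge0 g; lra.
  rewrite {1}BMn (le_trans (fsq_expM_le _ _ gA0 (fB b))) //.
  rewrite [X in X * V]mulrC -mulrA ler_wpM2l ?exprn_ge0 //.
  rewrite -[X in fsq X]mul1mx -FCA mulmx_suml (le_trans (fsq_sum_le _)) // -mulrA.
  rewrite ler_wpM2l ?exprn_ge0 // mulr_suml ler_sum // => k _.
  by rewrite -mulmxA (le_trans (fsqM _ _)) // -mulrA ler_wpM2l ?fsq_ge0.
rewrite QE.
have -> : \sum_(k < n) fdot (D k *m (A *m X)) (D k *m X) =
    fdot (C *m X) (\sum_(l < n) D l *m X)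
    - g * \sum_(k < n) fdot (\sum_(l < k.+1) D l *m X) (D k *m X).
  rewrite fdot_sumr mulr_sumr -sumrB; apply: eq_bigr => k _.
  by rewrite mulmxA DA mulmxBl fdotDl fdotNl -scalemxAl fdotZl mulmx_suml.
rewrite mulrBr mulrCA (fdot_partial_sums n (fun l => D l *m X)).
(* Completing the square: the term [- g * fsq s] from the partial sums absorbs the cross term with
   [C *m X], leaving [g^-1 * fsq (C *m X)]. *)
have := fsq_ge0 (C *m X - g *: (\sum_(l < n) D l *m X)).
set s := \sum_(l < n) _; rewrite fsqB fsqZ fdotZr -/V => h.
have : 0 <= g^-1 * (fsq (C *m X) - 2 * (g * fdot (C *m X) s) + g ^+ 2 * fsq s).
  by rewrite mulr_ge0 // invr_ge0 ltW.
rewrite mulrDr mulrBr expr2 !mulrA [g^-1 * 2]mulrC -!mulrA mulKf ?gt_eqF // mulKf ?gt_eqF //.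
lra.
Qed.

(** * Coercivity of graph Laplacians *)

Lemma orth_proj_ker0 (R : fieldType) N (H P : 'M[R]_N) : orth_proj_ker H P ->
  H *m P = 0.
Proof.
move=> [_ [PP HP]]; apply/row_matrixP => i; rewrite row0; apply/rowP => j.
have /HP/matrixP/(_ i 0) : P *m (P *m delta_mx j 0) = P *m (delta_mx j 0 : 'cV_N).
  by rewrite mulmxA PP.
by rewrite mulmxA -colE !mxE.
Qed.

(** An argument without eigenvalues. [P] fixes the columns of the cokernel of [H], so [1%:M - P]
    factors through [H] and [Z *m (1%:M - P)] is controlled by [Z *m H]. The latter is controlled by
    the quadratic form, through its positivity at [h *: Z - Z *m H]. *)
Lemma orth_proj_ker_coercive (R : realFieldType) N (H P : 'M[R]_N) :
  H^T = H -> (forall b (Z : 'M[R]_(b, N)), 0 <= fdot (Z *m H) Z) ->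
  orth_proj_ker H P ->
  exists2 mu, 0 < mu &
    forall b (Z : 'M[R]_(b, N)), mu * fsq (Z *m (1%:M - P)) <= fdot (Z *m H) Z.
Proof.
move=> Hs Hpos HP; have [Ps [PP kerP]] := HP.
have /submxP[G GH] : (1%:M - P <= H)%MS.
  rewrite submxE; apply/eqP/matrixP => i j.
  have Pc : P *m col j (cokermx H) = col j (cokermx H).
    by apply/kerP; rewrite colE mulmxA mulmx_coker mul0mx.
  move/matrixP/(_ i 0): Pc; rewrite mulmxBl mul1mx colE mulmxA -!colE.
  by rewrite !mxE => ->; rewrite subrr.
have HG : 1%:M - P = H *m G^T.
  have <- : (1%:M - P)^T = 1%:M - P by rewrite linearB /= trmx1 Ps.
  by rewrite GH trmx_mul Hs.
set h := fsq H + 1; have h0 : 0 < h by rewrite ltr_wpDl ?fsq_ge0.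
set g := fsq G^T + 1; have g0 : 0 < g by rewrite ltr_wpDl ?fsq_ge0.
exists (g * h)^-1; first by rewrite invr_gt0 mulr_gt0.
move=> b Z.
have up (Y : 'M[R]_(b, N)) : fdot (Y *m H) Y <= h * fsq Y.
  have := fsq_ge0 (Y *m H - Y); rewrite fsqB => h1.
  by have := fsqM Y H; have := fsq_ge0 Y; have := fsq_ge0 (Y *m H); rewrite /h; lra.
have low : fsq (Z *m H) <= h * fdot (Z *m H) Z.
  have := Hpos b (h *: Z - Z *m H); have := up (Z *m H).
  rewrite mulmxBl !fdotDl !fdotDr !fdotNl !fdotNr -!scalemxAl !fdotZl !fdotZr.
  rewrite (fdot_mulr (Z *m H) H Z) Hs -!/(fsq _) => h1 h2.
  have : 0 <= h * (h * fdot (Z *m H) Z - fsq (Z *m H)) by lra.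
  by rewrite pmulr_rge0 // subr_ge0.
rewrite ler_pdivrMl ?mulr_gt0 // HG mulmxA (le_trans (fsqM _ _)) // mulrC -mulrA.
apply: ler_pM; rewrite ?fsq_ge0 //.
by rewrite /g lerDl.
Qed.

Section Graph.
Variables (R : realFieldType) (N n0 : nat) (Ebar : 'I_n0 -> rel 'I_N.+1).
Hypothesis irrE : forall p i, ~~ Ebar p i i.
Variable p : 'I_n0.
Hypothesis symE : forall i j : 'I_N,
  Ebar p (node j) (node i) = Ebar p (node i) (node j).

Let w i j := adj R Ebar p i j.

Lemma HmatE i j : Hmat R Ebar p i j =
  (\sum_l w (node i) (node l) + w (node i) ord0) *+ (i == j) - w (node i) (node j).
Proof.
rewrite /Hmat !mxE; have [<-|ij] := eqVneq i j.
  by rewrite /w /adj (negPf (irrE p _)) subr0.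
by rewrite mulr0n addr0 add0r.
Qed.

Lemma adj_sym i j : w (node i) (node j) = w (node j) (node i).
Proof. by rewrite /w /adj symE. Qed.

Lemma trmx_Hmat : (Hmat R Ebar p)^T = Hmat R Ebar p.
Proof.
apply/matrixP => i j; rewrite mxE !HmatE eq_sym adj_sym.
by have [->|] := eqVneq i j.
Qed.

Lemma mulmx_HmatE b (X : 'M[R]_(b, N)) k i : (X *m Hmat R Ebar p) k i =
  \sum_j w (node i) (node j) * (X k i - X k j) + w (node i) ord0 * X k i.
Proof.
rewrite -trmx_Hmat mxE; pose d := \sum_l w (node i) (node l) + w (node i) ord0.
under eq_bigr => j _ do rewrite mxE HmatE -/d mulrBr.
rewrite sumrB (bigD1 i) //= eqxx mulr1n big1 ?addr0; last first.
  by move=> j ji; rewrite eq_sym (negPf ji) mulr0n mulr0.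
under [in RHS]eq_bigr => j _ do rewrite mulrBr.
rewrite sumrB -mulr_suml /d mulrDr addrAC (mulrC (X k i)); congr (_ - _ + _).
  by apply: eq_bigr => j _; rewrite mulrC.
by rewrite mulrC.
Qed.

Lemma Hmat_psd b (X : 'M[R]_(b, N)) : 0 <= fdot (X *m Hmat R Ebar p) X.
Proof.
have w0 i j : 0 <= w i j by rewrite /w /adj ler0n.
rewrite fdotE; apply: sumr_ge0 => k _.
under eq_bigr => i _ do rewrite mulmx_HmatE mulrDl -mulrA -expr2.
rewrite big_split addr_ge0 //=; last first.
  by apply: sumr_ge0 => i _; rewrite mulr_ge0 ?sqr_ge0.
under eq_bigr => i _ do rewrite mulr_suml.
set S := \sum_i _.
(* Adding the sum to its copy with [i] and [j] exchanged leaves a sum of squares, the weights being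
   symmetric. *)
have : 2 * S = \sum_i \sum_j w (node i) (node j) * (X k i - X k j) ^+ 2.
  rewrite mulr_natl mulr2n {1}/S exchange_big /S -big_split; apply: eq_bigr => i _ /=.
  by rewrite -big_split; apply: eq_bigr => j _ /=; rewrite (adj_sym j); ring.
move=> E; rewrite -(@pmulr_rge0 _ 2) // E.
by do 2!(apply: sumr_ge0 => ? _); rewrite mulr_ge0 ?sqr_ge0.
Qed.

End Graph.

(** * Linear matrix differential equations *)

Section Entrywise.
Variable R : realType.
Local Open Scope classical_set_scope.

Lemma cvg_fsum (T : Type) (F : set_system T) (FF : Filter F) (I : Type) (r : seq I)
    (h : I -> T -> R) (l : I -> R) : (forall i, h i s @[s --> F] --> l i) ->
  \sum_(i <- r) h i s @[s --> F] --> \sum_(i <- r) l i.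
Proof.
by move=> hl; apply: cvg_big => //; exact: add_continuous.
Qed.

Lemma cvg_mulmx (T : Type) (F : set_system T) (FF : Filter F) a b c d
    (A : 'M[R]_(a, b)) (H : 'M[R]_(c, d)) (u : T -> 'M[R]_(b, c)) (x : 'M[R]_(b, c)) :
  (forall i j, u s i j @[s --> F] --> x i j) ->
  forall i j, (A *m u s *m H) i j @[s --> F] --> (A *m x *m H) i j.
Proof.
move=> ux i j.
rewrite (_ : (fun s => _) = fun s => \sum_(k < c) (\sum_(l < b) A i l * u s l k) * H k j).
  rewrite mxE; under eq_bigr do rewrite mxE.
  apply: cvg_fsum => k; apply: cvgM; last exact: cvg_cst.
  by apply: cvg_fsum => l; apply: cvgM; [exact: cvg_cst|exact: ux].
by apply/funext => s; rewrite mxE; apply: eq_bigr => k _; rewrite mxE.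
Qed.

Lemma is_derive_fsum (I : Type) (r : seq I) (h : I -> R -> R) (dh : I -> R) (t : R) :
  (forall i, is_derive t (1 : R) (h i) (dh i)) ->
  is_derive t (1 : R) (fun s => \sum_(i <- r) h i s) (\sum_(i <- r) dh i).
Proof.
move=> dhi; elim: r => [|i r IH].
  rewrite big_nil (_ : (fun s => _) = cst 0); first exact: is_derive_cst.
  by apply/funext => s; rewrite big_nil.
rewrite big_cons (_ : (fun s => _) = h i + (fun s => \sum_(i <- r) h i s)).
  exact: is_deriveD.
by apply/funext => s; rewrite big_cons.
Qed.

Lemma is_derive_mulmx a b c d (A : 'M[R]_(a, b)) (H : 'M[R]_(c, d))
    (u : R -> 'M[R]_(b, c)) (du : 'M[R]_(b, c)) t :
  (forall i j, is_derive t (1 : R) (fun s => u s i j) (du i j)) ->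
  forall i j, is_derive t (1 : R) (fun s => (A *m u s *m H) i j) ((A *m du *m H) i j).
Proof.
move=> ux i j.
rewrite (_ : (fun s => _) = fun s => \sum_(k < c) \sum_(l < b) (A i l * H k j) * u s l k).
  have -> : (A *m du *m H) i j = \sum_(k < c) \sum_(l < b) (A i l * H k j) * du l k.
    rewrite mxE; apply: eq_bigr => k _; rewrite mxE mulr_suml.
    by apply: eq_bigr => l _; rewrite mulrAC.
  apply: is_derive_fsum => k; apply: is_derive_fsum => l; exact: is_deriveZ.
apply/funext => s; rewrite mxE; apply: eq_bigr => k _; rewrite mxE mulr_suml.
by apply: eq_bigr => l _; rewrite mulrAC.
Qed.

Lemma is_derive_fdot a b (Q : 'M[R]_a) (u : R -> 'M[R]_(a, b)) (du : 'M[R]_(a, b)) t :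
  Q^T = Q ->
  (forall i j, is_derive t (1 : R) (fun s => u s i j) (du i j)) ->
  is_derive t (1 : R) (fun s => fdot (u s) (Q *m u s)) (2 * fdot du (Q *m u t)).
Proof.
move=> Qs dux.
have dQ i j : is_derive t (1 : R) (fun s => (Q *m u s) i j) ((Q *m du) i j).
  rewrite -[Q *m du]mulmx1 (_ : (fun s => _) = fun s => (Q *m u s *m 1%:M) i j).
    exact: is_derive_mulmx.
  by apply/funext => s; rewrite mulmx1.
rewrite (_ : (fun s => _) = fun s => \sum_i \sum_j u s i j * (Q *m u s) i j); last first.
  by apply/funext => s; rewrite fdotE.
have -> : 2 * fdot du (Q *m u t) =
    \sum_i \sum_j (u t i j * (Q *m du) i j + (Q *m u t) i j * du i j).
  rewrite mulr_natl mulr2n {1}fdotC fdot_mull Qs !fdotE -big_split.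
  apply: eq_bigr => i _; rewrite -big_split; apply: eq_bigr => j _ /=.
  by rewrite (mulrC (du i j)).
apply: is_derive_fsum => i; apply: is_derive_fsum => j; exact: is_deriveM.
Qed.

End Entrywise.

Section SylvesterFlow.
Variables (R : realType) (a b : nat) (A B : 'M[R]_a) (H : 'M[R]_b).
Local Open Scope classical_set_scope.

Let f (X : 'M[R]_(a, b)) := A *m X + B *m X *m H.

Let coef X i j k := (iter k f X) i j / k`!%:R.

Let fsq_f : exists2 k : R, 0 <= k & forall X, fsq (f X) <= k ^+ 2 * fsq X.
Proof.
have A0 := fsq_ge0 A; have BH0 : 0 <= fsq B * fsq H by rewrite mulr_ge0 ?fsq_ge0.
exists (2 * fsq A + 2 * (fsq B * fsq H) + 1) => [|X]; first by lra.
have X0 := fsq_ge0 X.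
apply: (@le_trans _ _ ((2 * fsq A + 2 * (fsq B * fsq H)) * fsq X)).
  have := fsqD_le (A *m X) (B *m X *m H); have := fsqM A X.
  have := fsqM (B *m X) H; have : fsq (B *m X) * fsq H <= fsq B * fsq X * fsq H.
    by rewrite ler_wpM2r ?fsq_ge0 ?fsqM.
  rewrite /f; lra.
rewrite ler_wpM2r //; set x := 2 * fsq A + _.
have : 0 <= x by rewrite /x; lra.
nra.
Qed.

(** Iterates of [f] grow at most geometrically, so an exponential series dominates. *)
Let cvg_coef X i j K : cvgn (pseries (coef X i j) K).
Proof.
have [k k0 fk] := fsq_f.
have itk p : fsq (iter p f X) <= (k ^+ p) ^+ 2 * fsq X.
  elim: p => [|p IH]; first by rewrite expr1n mul1r.
  rewrite iterS (le_trans (fk _)) // [k ^+ p.+1]exprS exprMn -[leRHS]mulrA.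
  by apply: ler_wpM2l => //; exact: sqr_ge0.
have ent p : `|iter p f X i j| <= k ^+ p * (fsq X + 1).
  have X0 := fsq_ge0 X; have kp : 0 <= k ^+ p by rewrite exprn_ge0.
  rewrite -(@ler_pXn2r _ 2) ?nnegrE ?mulr_ge0 //; last lra.
  rewrite real_normK ?num_real // (le_trans (entry_le_fsq _ _ _)) // (le_trans (itk p)) //.
  by rewrite exprMn ler_wpM2l ?sqr_ge0 //; nra.
apply: normed_cvg.
apply: (@series_le_cvg _ _ (fun p => (fsq X + 1) * exp_coeff (k * `|K|) p)) => [p|p|p|].
- exact: normr_ge0.
- by rewrite mulr_ge0 ?exp_coeff_ge0 ?mulr_ge0 // addr_ge0 ?fsq_ge0.
- rewrite /exp_coeff /coef /= normrM normrM normfV normr_nat normrX exprMn.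
  rewrite [leLHS]mulrAC !mulrA ler_wpM2r ?invr_ge0 // ler_wpM2r ?exprn_ge0 //.
  by rewrite mulrC ent.
by apply: is_cvg_seriesZ; exact: is_cvg_series_exp_coeff.
Qed.

Let diffs_coef X i j : pseries_diffs (coef X i j) = coef (f X) i j.
Proof.
apply/funext => k; rewrite /pseries_diffs /coef -iterSr factS natrM.
by rewrite invfM [LHS]mulrCA mulVKf ?pnatr_eq0.
Qed.

(** The solution is the exponential series of the linear map [f], read entry by entry as a real
    power series. Its termwise derivative is the series started at [f X0], and [f] passes to the
    limit. *)
Lemma sylvester_flow (X0 : 'M[R]_(a, b)) : exists x : R -> 'M[R]_(a, b), x 0 = X0 /\
  forall t i j, is_derive t (1 : R) (fun s => x s i j)
    ((A *m x t + B *m x t *m H) i j).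
Proof.
pose x t : 'M[R]_(a, b) := \matrix_(i, j) limn (pseries (coef X0 i j) t).
exists x; split.
  apply/matrixP => i j; rewrite mxE; apply: lim_near_cst => //.
  near=> p; rewrite /pseries /series /= -[p]prednK; last by near: p.
  rewrite big_nat_recl // big1 ?addr0; first by rewrite /coef /= fact0 expr0 divr1 mulr1.
  by move=> k _; rewrite expr0n mulr0.
move=> t i j.
rewrite (_ : (fun s => _) = fun s => limn (pseries (coef X0 i j) s)); last first.
  by apply/funext => s; rewrite mxE.
have -> : (A *m x t + B *m x t *m H) i j = limn (pseries (pseries_diffs (coef X0 i j)) t).
  rewrite diffs_coef; apply/esym/cvg_lim => //.
  pose u p : 'M[R]_(a, b) := \sum_(0 <= k < p) (t ^+ k / k`!%:R) *: iter k f X0.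
  have ux k l : u p k l @[p --> \oo] --> x t k l.
    rewrite mxE (_ : (fun p => _) = pseries (coef X0 k l) t); first exact: cvg_coef.
    apply/funext => p; rewrite /u summxE; apply: eq_bigr => q _.
    by rewrite mxE /coef /=; ring.
  rewrite (_ : pseries _ _ = fun p => (A *m u p *m 1%:M) i j + (B *m u p *m H) i j).
    by rewrite mxE -[A *m x t]mulmx1; apply: cvgD; exact: cvg_mulmx.
  apply/funext => p; rewrite mulmx1.
  transitivity ((A *m u p + B *m u p *m H) i j); last by rewrite mxE.
  rewrite /u !mulmx_sumr mulmx_suml -big_split summxE; apply: eq_bigr => q _ /=.
  rewrite -!scalemxAr -scalemxAl -scalerDr /coef -iterSr iterS [in RHS]mxE.
  by rewrite /f; ring.
apply: (@pseries_snd_diffs _ _ (`|t| + 1)); rewrite ?diffs_coef //.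
by rewrite [ltRHS]ger0_norm ?addr_ge0 // ltrDl.
Unshelve. all: by end_near. Qed.

End SylvesterFlow.

Section SolvesOn.
Local Open Scope classical_set_scope.

(** The product of [v] with [expR (- k * t)] is nonincreasing. Derivatives are asked only inside the
    interval because solutions may have corners at switching instants; a negative [k] gives
    decay. *)
Lemma gronwall_le (R : realType) (v dv : R -> R) (a b k : R) : a <= b ->
  {within `[a, b], continuous v} ->
  (forall t, a < t < b -> is_derive t (1 : R) v (dv t) /\ dv t <= k * v t) ->
  v b <= expR (k * (b - a)) * v a.
Proof.
rewrite le_eqVlt => /predU1P[-> _ _|ab vc dvk]; first by rewrite subrr mulr0 expR0 mul1r.
pose e t : R := expR ((- k) * t).
have de t : is_derive t (1 : R) e (- k * e t).
  rewrite (_ : e = expR \o ( *%R (- k))) //; apply: is_derive_eq.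
  by rewrite /e /GRing.scale /= mulr1 mulrC.
pose w := v * e.
have dw t : a < t < b -> is_derive t (1 : R) w (e t * dv t - k * (v t * e t)).
  move=> /dvk[dvt _]; apply: is_derive_eq.
  by rewrite /GRing.scale /=; ring.
have wba : w b <= w a.
  apply: (@ler0_derive1_le_cc _ w a b); rewrite ?in_itv /= ?lexx ?ltW //.
  - by move=> t; rewrite in_itv /= => /dw[].
  - move=> t; rewrite in_itv /= => tab; have [_ H] := dvk t tab.
    have dwt := dw t tab; rewrite derive1E derive_val.
    by have := expR_gt0 (- k * t); rewrite -/(e t); nra.
  - move=> t; apply: (@cvgM _ _ (nbhs t)); first exact: vc.
    apply: continuous_subspaceT => {}t.
    by apply: differentiable_continuous; apply/derivable1_diffP; case: (de t).
have -> : expR (k * (b - a)) = expR (- k * a) * expR (k * b).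
  by rewrite -expRD; congr expR; ring.
have -> : v b = w b * expR (k * b).
  by rewrite /w !fctE /e -mulrA -expRD mulNr addNr expR0 mulr1.
by rewrite -mulrA [_ * v a]mulrC mulrA ler_pM2r ?expR_gt0 // mulrC.
Qed.

(** This is what a solution offers between two consecutive switching instants, entrywise as in
    [is_solution]. *)
Definition solves_on (R : realType) (a b : nat) (f : 'M[R]_(a, b) -> 'M[R]_(a, b))
   
    (s t : R) (X : R -> 'M[R]_(a, b)) : Prop :=
  (forall i j, {within `[s, t], continuous (fun r => X r i j)}) /\
  (forall r, s < r < t -> forall i j,
     is_derive r (1 : R) (fun x => X x i j) (f (X r) i j)).

Lemma solves_on_sub (R : realType) a b (f : 'M[R]_(a, b) -> 'M[R]_(a, b))
    (s t t' : R) (X : R -> 'M[R]_(a, b)) :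
  t' <= t -> solves_on f s t X -> solves_on f s t' X.
Proof.
move=> t't [Xc Xd]; split.
  move=> i j; apply: continuous_subspaceW (Xc i j) => r /=; rewrite !in_itv /=.
  by move=> /andP[-> rt']; rewrite (le_trans rt').
by move=> r /andP[sr rt'] i j; apply: Xd; rewrite sr (lt_le_trans rt').
Qed.

Lemma solves_on_derivable (R : realType) a b (f : 'M[R]_(a, b) -> 'M[R]_(a, b))
    (s t : R) (X : R -> 'M[R]_(a, b)) :
  (forall r i j, is_derive r (1 : R) (fun x => X x i j) (f (X r) i j)) ->
  solves_on f s t X.
Proof.
move=> Xd; split=> // i j; apply: continuous_subspaceT => r.
by apply: differentiable_continuous; apply/derivable1_diffP; case: (Xd r i j).
Qed.

Lemma cvg_mulmxl (R : realType) (T : Type) (F : set_system T) (FF : Filter F) a b c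
    (A : 'M[R]_(a, b)) (u : T -> 'M[R]_(b, c)) (x : 'M[R]_(b, c)) :
  (forall i j, u s i j @[s --> F] --> x i j) ->
  forall i j, (A *m u s) i j @[s --> F] --> (A *m x) i j.
Proof.
move=> ux i j; have := @cvg_mulmx _ _ _ FF _ _ _ _ A 1%:M u x ux i j.
by rewrite mulmx1; under eq_fun do rewrite mulmx1.
Qed.

(** Its main use takes for [P] a projection or its complement, which isolates the two parts of the
    error. *)
Lemma solves_on_mulmx (R : realType) a b c d (f : 'M[R]_(a, b) -> 'M[R]_(a, b))
    (g : 'M[R]_(c, d) -> 'M[R]_(c, d)) (B : 'M[R]_(c, a)) (P : 'M[R]_(b, d))
    (s t : R) (X : R -> 'M[R]_(a, b)) :
  (forall r, B *m f (X r) *m P = g (B *m X r *m P)) ->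
  solves_on f s t X -> solves_on g s t (fun r => B *m X r *m P).
Proof.
move=> fg [Xc Xd]; split.
  move=> i j r; apply: cvg_mulmx => k l; exact: Xc.
by move=> r rst i j; rewrite -fg; apply: is_derive_mulmx; exact: Xd.
Qed.

Lemma solves_onB (R : realType) a b (f : 'M[R]_(a, b) -> 'M[R]_(a, b))
    (s t : R) (X Y : R -> 'M[R]_(a, b)) :
  (forall U V, f (U - V) = f U - f V) ->
  solves_on f s t X -> solves_on f s t Y -> solves_on f s t (fun r => X r - Y r).
Proof.
move=> fB [Xc Xd] [Yc Yd]; split.
  move=> i j; rewrite (_ : (fun r => _) = (fun r => X r i j) - (fun r => Y r i j)).
    exact: within_continuousB.
  by apply/funext => r; rewrite !mxE.
move=> r rst i j; rewrite fB.
rewrite (_ : (fun r => _) = (fun r => X r i j) - (fun r => Y r i j)).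
  by rewrite !mxE; apply: is_deriveB; [exact: Xd|exact: Yd].
by apply/funext => x; rewrite !mxE.
Qed.

Lemma solves_on_energy (R : realType) a b (f : 'M[R]_(a, b) -> 'M[R]_(a, b))
    (s t : R) (X : R -> 'M[R]_(a, b)) (Q : 'M[R]_a) k : Q^T = Q -> s <= t ->
  (forall r, 2 * fdot (f (X r)) (Q *m X r) <= k * fdot (X r) (Q *m X r)) ->
  solves_on f s t X ->
  fdot (X t) (Q *m X t) <= expR (k * (t - s)) * fdot (X s) (Q *m X s).
Proof.
move=> Qs st fk [Xc Xd].
apply: (@gronwall_le _ (fun r => fdot (X r) (Q *m X r))
  (fun r => 2 * fdot (f (X r)) (Q *m X r))) => //; last first.
  by move=> r rst; split; [apply: is_derive_fdot => //; exact: Xd|exact: fk].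
rewrite (_ : (fun r => _) = fun r => \sum_i \sum_j X r i j * (Q *m X r) i j); last first.
  by apply/funext => r; rewrite fdotE.
move=> r; apply: cvg_fsum => i; apply: cvg_fsum => j; apply: cvgM; first exact: Xc.
by apply: cvg_mulmxl => k' l; exact: Xc.
Qed.

End SolvesOn.

(** * Errors on one switching interval *)

Lemma is_derive_shift (R : realType) (g : R -> R) (s r d : R) :
  is_derive (r - s) (1 : R) g d -> is_derive r (1 : R) (fun x => g (x - s)) d.
Proof.
move=> gd; have := @is_derive1_comp _ g (fun x => x - s) r d 1.
rewrite mulr1; apply => //.
by rewrite -[X in is_derive _ _ _ X]subr0; apply: is_deriveB.
Qed.

Section AdaptedFlow.
Variables (R : realType) (n q : nat) (A : 'M[R]_n) (S : 'M[R]_(q, n)) (G : 'M[R]_(n, q)).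
Variable beta : R.
Hypothesis GS : G *m S = 1%:M.
Hypothesis Sbeta : forall b (X : 'M[R]_(n, b)),
  fdot (S *m (A *m X)) (S *m X) <= beta * fsq (S *m X).

Lemma adapted_flow_le b (s t : R) (X : R -> 'M[R]_(n, b)) : s <= t ->
  solves_on (mulmx A) s t X ->
  fnorm (S *m X t) <= expR (beta * (t - s)) * fnorm (S *m X s).
Proof.
move=> st Xsol; apply: fnorm_le; first exact: expR_ge0.
have fdotS (Y Z : 'M[R]_(n, b)) : fdot Y (S^T *m S *m Z) = fdot (S *m Y) (S *m Z).
  by rewrite fdot_mull mulmxA.
have := @solves_on_energy _ _ _ (mulmx A) s t X (S^T *m S) (2 * beta).
rewrite !fdotS -!/(fsq _) -expRM_natl mulrA; apply => //.
  by rewrite trmx_mul trmxK.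
by move=> r; rewrite !fdotS -mulrA ler_pM2l // Sbeta.
Qed.

(** The growth estimate is applied to the difference of the solutions; [G] then removes the weight
    [S]. *)
Lemma flow_unique b (s t : R) (X Y : R -> 'M[R]_(n, b)) : s <= t ->
  solves_on (mulmx A) s t X -> solves_on (mulmx A) s t Y -> X s = Y s -> X t = Y t.
Proof.
move=> st Xs Ys XY.
have := adapted_flow_le st (solves_onB (mulmxBr A) Xs Ys).
rewrite XY subrr mulmx0 {2}/fnorm fsq0 sqrtr0 mulr0 => le0.
apply/eqP; rewrite -subr_eq0 -[X in X == 0]mul1mx -GS -mulmxA.
rewrite (fsq_le0 (X := S *m _)) ?mulmx0 // -sqr_fnorm.
by rewrite (le_anti (introT andP (conj le0 (fnorm_ge0 _)))) expr0n.
Qed.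

Variable Phi : R -> 'M[R]_n.
Hypothesis Phi0 : Phi 0 = 1%:M.
Hypothesis dPhi : forall t i j, is_derive t (1 : R) (fun s => Phi s i j) ((A *m Phi t) i j).

Lemma solves_on_flow b (s t : R) (X : 'M[R]_(n, b)) :
  solves_on (mulmx A) s t (fun r => Phi (r - s) *m X).
Proof.
have : solves_on (mulmx A) s t (fun r => 1%:M *m Phi (r - s) *m X).
  apply: (@solves_on_mulmx _ _ _ _ _ (mulmx A)).
    by move=> r; rewrite !mul1mx mulmxA.
  by apply: solves_on_derivable => r i j; exact: is_derive_shift.
by under eq_fun do rewrite mul1mx.
Qed.

Lemma flow_le b (h : R) (X : 'M[R]_(n, b)) : 0 <= h ->
  fnorm (S *m (Phi h *m X)) <= expR (beta * h) * fnorm (S *m X).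
Proof.
move=> h0; have := adapted_flow_le h0 (solves_on_flow 0 h X).
by rewrite !subr0 Phi0 mul1mx.
Qed.

End AdaptedFlow.

(** Column [i] of [X] is the error of follower [i]: the dynamics act on the left and the graph on
    the right, in place of a Kronecker product. *)
Definition errf (R : pzRingType) n N (A B : 'M[R]_n) (H : 'M[R]_N) (X : 'M[R]_(n, N)) :=
  A *m X - B *m X *m H.

(** Multiplication by [P] on the right kills the injection, so [E *m P] is an exact trajectory of
    [A], whatever the gain; uniqueness concludes. *)
Lemma errf_kernel_part (R : realType) n q N (A B : 'M[R]_n) (S : 'M[R]_(q, n)) G beta
    (Phi : R -> 'M[R]_n) (H P : 'M[R]_N) (s t : R) (E : R -> 'M[R]_(n, N)) :
  G *m S = 1%:M ->
  (forall b (X : 'M[R]_(n, b)), fdot (S *m (A *m X)) (S *m X) <= beta * fsq (S *m X)) ->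
  Phi 0 = 1%:M ->
  (forall t i j, is_derive t (1 : R) (fun s => Phi s i j) ((A *m Phi t) i j)) ->
  H *m P = 0 -> s <= t -> solves_on (errf A B H) s t E ->
  E t *m P = Phi (t - s) *m (E s *m P).
Proof.
move=> GS Sb Phi0 dPhi HP st Es.
apply: (flow_unique GS Sb st _ (solves_on_flow dPhi s t (E s *m P))
          (X := fun r => E r *m P)); last by rewrite subrr Phi0 mul1mx.
have : solves_on (mulmx A) s t (fun r => 1%:M *m E r *m P).
  apply: solves_on_mulmx Es => r.
  by rewrite !mul1mx /errf mulmxBl -!mulmxA HP !mulmx0 subr0.
by under eq_fun do rewrite mul1mx.
Qed.

(** The term of degree [2 * n + 1] of the exponential series beats the polynomial of degree [2 * n]
    by one factor [g]: for [g] at least [1] the quantity is at most [K / g]. *)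
Lemma polyexp_small (R : realType) (c a tau h g0 : R) (n : nat) :
  0 <= c -> 0 <= a -> 0 < tau -> 0 < h ->
  exists g, g0 <= g /\ 0 < g /\ c * (2 * g ^+ 2 + a) ^+ n * expR (- g * tau) <= h.
Proof.
move=> c0 a0 tau0 h0.
pose k := (2 * n)%N; pose K := c * (2 + a) ^+ n * (k.+1`!%:R / tau ^+ k.+1).
have K0 : 0 <= K by rewrite !mulr_ge0 ?exprn_ge0 ?invr_ge0 ?exprn_ge0 ?addr_ge0 // ltW.
pose g := Num.max g0 (Num.max 1 (K / h)).
have g1 : 1 <= g by rewrite !le_max lexx orbT.
have g_gt0 : 0 < g by rewrite (lt_le_trans ltr01).
have gK : K / h <= g by rewrite !le_max lexx !orbT.
exists g; split; first by rewrite le_max lexx.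
split=> //.
have g2 : 1 <= g ^+ 2 by rewrite exprn_ege1.
have step1 : (2 * g ^+ 2 + a) ^+ n <= (2 + a) ^+ n * g ^+ k.
  by rewrite /k exprM -exprMn; apply: lerXn2r; rewrite ?nnegrE; nra.
have step2 : expR (- g * tau) <= k.+1`!%:R / tau ^+ k.+1 / g ^+ k.+1.
  have -> : k.+1`!%:R / tau ^+ k.+1 / g ^+ k.+1 = ((g * tau) ^+ k.+1 / k.+1`!%:R)^-1.
    by rewrite exprMn !invfM invrK [RHS]mulrC mulrA mulrAC.
  rewrite mulNr expRN lef_pV2 ?posrE ?expR_gt0 ?divr_gt0 ?exprn_gt0 ?mulr_gt0 //.
    by apply: le_trans (expR_ge1Dxn k _); rewrite ?lerDr ?mulr_ge0 // ltW.
apply: (@le_trans _ _ (K / g)).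
  apply: (@le_trans _ _ (c * ((2 + a) ^+ n * g ^+ k) * (k.+1`!%:R / tau ^+ k.+1 / g ^+ k.+1))).
    apply: ler_pM => //; [|exact: ler_wpM2l].
    by rewrite mulr_ge0 // exprn_ge0 // addr_ge0 // mulr_ge0 // sqr_ge0.
  rewrite [g ^+ k.+1]exprS /K le_eqVlt; apply/orP; left; apply/eqP.
  have : g ^+ k != 0 by rewrite expf_neq0 // gt_eqF.
  have : g != 0 by rewrite gt_eqF.
  have : tau ^+ k.+1 != 0 by rewrite expf_neq0 // gt_eqF.
  move: (tau ^+ k.+1) (g ^+ k) => x y x0 g00 y0; field.
  by rewrite x0 y0 g00.
by rewrite ler_pdivrMr // mulrC -ler_pdivrMr.
Qed.

(** With [L] a multiple of [invmx Q *m C^T], the injection contributes the quadratic form of [H] at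
    [C *m F], whose coercivity cancels the output term left by [observer_form]. The gain depends on
    the graph through [mu] alone, so one [L] serves all graphs. *)
Lemma high_gain (R : realType) n m q (C : 'M[R]_(m, n)) (A : 'M[R]_n)
    (S : 'M[R]_(q, n)) (G : 'M[R]_(n, q)) (mu tau eps : R) :
  observable C A -> G *m S = 1%:M -> 0 < mu -> 0 < tau -> 0 < eps ->
  exists (L : 'M[R]_(n, m)) (K : R), 0 <= K /\
  forall N (H P : 'M[R]_N) (s t : R) (E : R -> 'M[R]_(n, N)),
    orth_proj_ker H P ->
    (forall b (Z : 'M[R]_(b, N)), mu * fsq (Z *m (1%:M - P)) <= fdot (Z *m H) Z) ->
    H^T = H -> s <= t -> solves_on (errf A (L *m C) H) s t E ->
    fnorm (S *m (E t *m (1%:M - P))) <= K * fnorm (S *m E s) /\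
    (tau <= t - s ->
      fnorm (S *m (E t *m (1%:M - P))) <= eps * fnorm (S *m E s)).
Proof.
move=> obs GS mu0 tau0 eps0.
have [g0 [c1 [c2 [g0_gt0 c10 c20 form]]]] := observer_form obs.
(* [fsq S] and [fsq G] convert between weighted and plain norms, [c1] and [c2] between plain norms
   and the form of [Q]. These are squares, hence the tolerance [eps ^+ 2] below. *)
pose c := fsq S * (c2 * (c1 * fsq G)).
have c_ge0 : 0 <= c by rewrite !mulr_ge0 ?fsq_ge0.
have A20 : 0 <= 2 * fsq A by rewrite mulr_ge0 ?fsq_ge0.
have [g [gg0 [g_gt0 small]]] :=
  polyexp_small g0 n c_ge0 A20 tau0 (exprn_gt0 2 eps0).
have [Q [Qs Qf]] := form g gg0.
set p := (2 * g ^+ 2 + 2 * fsq A) ^+ n in small Qf.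
have p0 : 0 <= p by rewrite exprn_ge0 // addr_ge0 // mulr_ge0 // sqr_ge0.
have Qu : Q \in unitmx.
  apply: unitmx_mulmx_inj => v Qv; apply: fsq_le0.
  by have [_ _ + _] := Qf _ v; rewrite Qv /fdot mulmx0 mxtrace0 mulr0.
(* Chosen so that [2 * kap * mu] is [g^-1], the coefficient of the output term. *)
pose kap := (2 * mu * g)^-1.
have kap0 : 0 <= kap by rewrite invr_ge0 !mulr_ge0 // ltW.
exists (kap *: (invmx Q *m C^T)), (c * p + 1); split.
  by rewrite addr_ge0 // mulr_ge0.
move=> N H P s t E HP coer Hs st Esol.
have [Ps [PP _]] := HP; have HP0 := orth_proj_ker0 HP.
have PH0 : P *m H = 0 by rewrite -Ps -Hs -trmx_mul HP0 trmx0.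
set L := kap *: _ in Esol *; set F := fun r => E r *m (1%:M - P).
(* [P] commutes with [H], both products being zero, so the complementary part obeys the same
   equation. *)
have Fsol : solves_on (errf A (L *m C) H) s t F.
  have : solves_on (errf A (L *m C) H) s t (fun r => 1%:M *m E r *m (1%:M - P)).
    apply: solves_on_mulmx Esol => r.
    rewrite !mul1mx /errf mulmxBl -!mulmxA; congr (_ - _ *m (_ *m (_ *m _))).
    by rewrite mulmxBr mulmx1 HP0 mulmxBl mul1mx PH0.
  by under eq_fun do rewrite mul1mx.
have decay : fdot (F t) (Q *m F t) <= expR (- g * (t - s)) * fdot (F s) (Q *m F s).
  apply: solves_on_energy Fsol => // r.
  have [_ _ _ FQ] := Qf _ (F r).
  rewrite /errf fdotDl fdotNl mulrBr.
  have -> : fdot (L *m C *m F r *m H) (Q *m F r) = kap * fdot (C *m F r *m H) (C *m F r).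
    have QL : Q *m (L *m C *m F r *m H) = kap *: (C^T *m (C *m F r *m H)).
      by rewrite /L -!mulmxA -!scalemxAl -!scalemxAr !mulmxA mulmxV // mul1mx.
    by rewrite (fdotC _ (Q *m F r)) fdot_mull Qs QL fdotZr -fdot_mull fdotC.
  have := coer _ (C *m F r).
  have -> : C *m F r *m (1%:M - P) = C *m F r.
    rewrite /F -!mulmxA; congr (_ *m (_ *m _)).
    by rewrite mulmxBr mulmx1 mulmxBl mul1mx PP subrr subr0.
  move=> /(ler_wpM2l kap0).
  have -> : kap * (mu * fsq (C *m F r)) = g^-1 * fsq (C *m F r) / 2.
    by rewrite /kap; field; rewrite !gt_eqF.
  move: FQ; lra.
have bound : fsq (S *m F t) <= c * p * expR (- g * (t - s)) * fsq (S *m E s).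
  have [V0 _ Vlow _] := Qf _ (F t); have [_ Vup _ _] := Qf _ (F s).
  have P1s : (1%:M - P)^T = 1%:M - P by rewrite linearB /= trmx1 Ps.
  have P1P1 : (1%:M - P) *m (1%:M - P) = 1%:M - P.
    by rewrite mulmxBr mulmx1 mulmxBl mul1mx PP subrr subr0.
  have FE : fsq (F s) <= fsq G * fsq (S *m E s).
    rewrite -[F s]mul1mx -GS -mulmxA (le_trans (fsqM _ _)) // ler_wpM2l ?fsq_ge0 //.
    by rewrite /F mulmxA fsq_proj_le.
  apply: le_trans (fsqM _ _) _.
  have e0 := expR_ge0 (- g * (t - s)).
  have -> : c * p * expR (- g * (t - s)) * fsq (S *m E s) =
    fsq S * (c2 * p * (expR (- g * (t - s)) * (c1 * (fsq G * fsq (S *m E s))))).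
    by rewrite /c; ring.
  rewrite ler_wpM2l ?fsq_ge0 // (le_trans Vlow) // ler_wpM2l ?mulr_ge0 //.
  rewrite (le_trans decay) // ler_wpM2l // (le_trans Vup) // ler_wpM2l //.
have cp0 : 0 <= c * p by rewrite mulr_ge0.
have SE0 := fsq_ge0 (S *m E s).
split=> [|ts]; apply: fnorm_le.
- by rewrite addr_ge0.
- apply: le_trans bound _; apply: ler_wpM2r => //.
  apply: (@le_trans _ _ (c * p * 1)); last by nra.
  by rewrite ler_wpM2l // -expR0 ler_expR mulNr oppr_le0 mulr_ge0 ?subr_ge0 // ltW.
- exact: ltW.
apply: le_trans bound _; apply: ler_wpM2r => //; apply: le_trans _ small.
by rewrite ler_wpM2l // ler_expR !mulNr lerN2 ler_wpM2l // ltW.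
Qed.

(** * Contraction over cycles *)

(** The rows of [X *m M^T] are the images under [M] of the rows of [X], so the operator norm carries
    over to the Frobenius norm without a dimension factor. *)
Lemma opnorm_mul_le (R : realType) N (M : 'M[R]_N) (d : R) b (X : 'M[R]_(b, N)) :
  0 <= d -> opnorm M <= d -> fnorm (X *m M^T) <= d * fnorm X.
Proof.
move=> d0 Md; apply: fnorm_le => //.
suff Mv (v : 'cV[R]_N) : fsq (M *m v) <= d ^+ 2 * fsq v.
  rewrite (fsq_rows X) fsq_rows mulr_sumr; apply: ler_sum => i _.
  by rewrite row_mul trmx_mul trmxK.
have := fsq_ge0 v; rewrite le_eqVlt => /predU1P[/esym v0|v0].
  by rewrite (fsq_le0 (X := v)) ?v0 // mulmx0 !fsq0 mulr0.
have nv0 : 0 < fnorm v by rewrite sqrtr_gt0.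
pose w := (fnorm v)^-1 *: v.
have w1 : fsq w = 1 by rewrite fsqZ -sqr_fnorm -exprMn mulVf ?expr1n // gt_eqF.
have Mw : fnorm (M *m w) <= d.
  apply: le_trans Md; rewrite /opnorm; apply: ub_le_sup; last first.
    by exists w => /=; rewrite enorm_fnorm // /fnorm w1 sqrtr1.
  (* [sup] is an upper bound only for a bounded set; the Frobenius norm of [M] bounds this one. *)
  exists (fnorm M) => _ /= [u u1 <-]; rewrite enorm_fnorm -[leRHS]mulr1.
  rewrite enorm_fnorm in u1.
  apply: (@le_trans _ _ (fnorm M * fnorm u)); last by rewrite ler_wpM2l ?fnorm_ge0.
  by apply: fnorm_le; rewrite ?fnorm_ge0 // sqr_fnorm fsqM.
have -> : fsq (M *m v) = fsq v * fsq (M *m w).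
  by rewrite /w -scalemxAr fsqZ -(sqr_fnorm v) mulrA -exprMn mulfV ?expr1n ?mul1r // gt_eqF.
by rewrite mulrC ler_wpM2r ?fsq_ge0 // -sqr_fnorm lerXn2r ?nnegrE ?fnorm_ge0.
Qed.

Section Cycle.
Variables (R : realType) (n N q : nat) (S : 'M[R]_(q, n)).
Variables (ts : nat -> R) (beta eps Tc : R) (Phi : R -> 'M[R]_n).
Variables (X : nat -> 'M[R]_(n, N)) (P : nat -> 'M[R]_N).
Hypothesis beta0 : 0 <= beta.
Hypothesis eps01 : 0 <= eps <= 1.
Hypothesis tsS : forall r, ts r <= ts r.+1.
Hypothesis Phi_le : forall h (Y : 'M[R]_(n, N)), 0 <= h ->
  fnorm (S *m (Phi h *m Y)) <= expR (beta * h) * fnorm (S *m Y).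
Hypothesis P_le : forall r (Y : 'M[R]_(n, N)), fnorm (S *m (Y *m P r)) <= fnorm (S *m Y).
Hypothesis P_sym : forall r, (P r)^T = P r.
Hypothesis step : forall r,
  fnorm (S *m (X r.+1 - Phi (ts r.+1 - ts r) *m (X r *m P r))) <= eps * fnorm (S *m X r).

(** Crude growth per interval: a flow over time at most [Tc], plus a deviation factor [eps] of at
    most [1]. *)
Let B := expR (beta * Tc) + 1.

Let B1 : 1 <= B. Proof. by rewrite lerDr expR_ge0. Qed.

Let tsD r s : ts r <= ts (r + s).
Proof. by elim: s => [|s IH]; rewrite ?addn0 // addnS (le_trans IH). Qed.

Lemma cycle_growth r s : ts (r + s) - ts r <= Tc ->
  fnorm (S *m X (r + s)) <= B ^+ s * fnorm (S *m X r).
Proof.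
elim: s => [|s IH]; first by rewrite addn0 expr0 mul1r.
have [eps0 eps1] := andP eps01.
rewrite addnS => rs; have tt := tsS (r + s).
have {}IH : fnorm (S *m X (r + s)) <= B ^+ s * fnorm (S *m X r) by apply: IH; lra.
apply: (@le_trans _ _ (B * fnorm (S *m X (r + s)))); last first.
  by rewrite exprS -mulrA ler_wpM2l // (le_trans ler01).
have := step (r + s); set Y := Phi _ *m _ => D.
rewrite -(subrK Y (X _)) mulmxDr (le_trans (fnormD _ _)) //.
have YB : fnorm (S *m Y) <= expR (beta * Tc) * fnorm (S *m X (r + s)).
  rewrite (le_trans (Phi_le _ _)) ?subr_ge0 //.
  apply: ler_pM; rewrite ?expR_ge0 ?fnorm_ge0 ?P_le //.
  by rewrite ler_expR ler_wpM2l //; have := tsD r s; lra.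
have := fnorm_ge0 (S *m X (r + s)); rewrite /B; nra.
Qed.

(** [Psi] composes the flows of the cycle, so its bound involves the elapsed time only, with no loss
    per interval. The crude factor [B] is confined to the error, where [eps] multiplies it: at each
    step the old error is carried by one more flow and a new one of size [eps * B ^+ s] is added. *)
Lemma cycle_approx r s : ts (r + s) - ts r <= Tc ->
  exists2 Psi : 'M[R]_n,
    (forall Y : 'M[R]_(n, N),
       fnorm (S *m (Psi *m Y)) <= expR (beta * (ts (r + s) - ts r)) * fnorm (S *m Y)) &
    fnorm (S *m (X (r + s) -
        Psi *m (X r *m (\prod_(k <- rev (index_iota r (r + s))) P k)^T)))
      <= eps * s%:R * B ^+ s * fnorm (S *m X r).
Proof.
have [eps0 eps1] := andP eps01.
elim: s => [|s IH].
  exists 1%:M => [Y|]; first by rewrite addn0 subrr mulr0 expR0 mul1r mul1mx.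
  rewrite addn0 /index_iota subnn big_nil trmx1 mulmx1 mul1mx subrr mulmx0.
  by rewrite /fnorm fsq0 sqrtr0 mulr0 !mul0r.
rewrite addnS => rs; have tt := tsS (r + s); have tr := tsD r s.
have rs' : ts (r + s) - ts r <= Tc by lra.
have [Psi Psi_le Psi_err] := IH rs'.
set h := ts (r + s).+1 - ts (r + s).
have h0 : 0 <= h by rewrite subr_ge0.
exists (Phi h *m Psi) => [Y|].
  rewrite -mulmxA (le_trans (Phi_le _ _)) //.
  have -> : beta * (ts (r + s).+1 - ts r) = beta * h + beta * (ts (r + s) - ts r).
    by rewrite /h; ring.
  by rewrite expRD -mulrA ler_wpM2l ?expR_ge0.
(* The reversed list puts the latest projection leftmost; transposing, the factors being symmetric,
   gives the order in which they meet [X r] from the right. *)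
have -> : \prod_(k <- rev (index_iota r (r + s).+1)) P k =
    P (r + s)%N *m \prod_(k <- rev (index_iota r (r + s))) P k.
  rewrite /index_iota subSn ?leq_addr // addKn -{1}[s.+1]addn1 iotaD rev_cat /=.
  by rewrite big_cons.
rewrite trmx_mul P_sym; set Pr := (\prod_(_ <- _) _)^T.
set Err := X (r + s) - Psi *m (X r *m Pr) in Psi_err.
have -> : X (r + s).+1 - Phi h *m Psi *m (X r *m (Pr *m P (r + s)%N)) =
    (X (r + s).+1 - Phi h *m (X (r + s) *m P (r + s)%N)) + Phi h *m (Err *m P (r + s)%N).
  by rewrite /Err mulmxBl mulmxBr !mulmxA addrA subrK.
rewrite mulmxDr (le_trans (fnormD _ _)) //.
have D1 := le_trans (step (r + s)) (ler_wpM2l eps0 (cycle_growth rs')).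
have D2 : fnorm (S *m (Phi h *m (Err *m P (r + s)%N))) <=
    expR (beta * Tc) * (eps * s%:R * B ^+ s * fnorm (S *m X r)).
  rewrite (le_trans (Phi_le _ _)) //; apply: ler_pM; rewrite ?expR_ge0 ?fnorm_ge0 //.
    by rewrite ler_expR ler_wpM2l //; rewrite /h; lra.
  by rewrite (le_trans (P_le _ _)).
rewrite -/h in D1; apply: le_trans (lerD D1 D2) _.
set u := fnorm (S *m X r); have u0 : 0 <= u by exact: fnorm_ge0.
have Bs : 0 <= B ^+ s by rewrite exprn_ge0 // (le_trans ler01).
have x0 : 0 <= eps * (B ^+ s * u) by rewrite !mulr_ge0.
have -> : eps * s.+1%:R * B ^+ s.+1 * u = (s%:R + 1) * B * (eps * (B ^+ s * u)).
  by rewrite exprS -natr1; ring.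
have -> : expR (beta * Tc) * (eps * s%:R * B ^+ s * u) =
    s%:R * expR (beta * Tc) * (eps * (B ^+ s * u)) by ring.
rewrite -{1}[eps * _]mul1r -mulrDl ler_wpM2r // /B.
have := expR_ge0 (beta * Tc); have := ler0n R s; nra.
Qed.

(** [J] replaces the number of intervals so that one factor serves every cycle. *)
Lemma cycle_contraction r s delta J : 0 <= delta -> (s <= J)%N ->
  ts (r + s) - ts r <= Tc ->
  opnorm (\prod_(k <- rev (index_iota r (r + s))) P k) <= delta ->
  fnorm (S *m X (r + s)) <=
    (delta * expR (beta * Tc) + eps * (J%:R * B ^+ J)) * fnorm (S *m X r).
Proof.
move=> d0 sJ rs Pd; have [Psi Psi_le Psi_err] := cycle_approx rs.
have [eps0 eps1] := andP eps01; have tr := tsD r s.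
set Y := Psi *m _ in Psi_err.
rewrite -(subrK Y (X _)) mulmxDr (le_trans (fnormD _ _)) // addrC mulrDl.
have u0 := fnorm_ge0 (S *m X r).
apply: lerD.
  rewrite (le_trans (Psi_le _)) // [delta * _]mulrC -mulrA.
  apply: ler_pM; rewrite ?expR_ge0 ?fnorm_ge0 //.
    by rewrite ler_expR ler_wpM2l.
  by rewrite mulmxA opnorm_mul_le.
rewrite (le_trans Psi_err) // ler_wpM2r // -mulrA ler_wpM2l //.
by apply: ler_pM; rewrite ?ler_nat ?exprn_ge0 ?ler_weXn2l // (le_trans ler01).
Qed.

End Cycle.

(** Take the least index whose value exceeds [t]. The general order allows two uses: a time among
    switching instants, and a switching index among cycles. *)
Lemma locate_interval d (T : orderType d) (f : nat -> T) (t : T) :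
  (f 0%N <= t)%O -> (exists k, (t < f k)%O) -> exists k, (f k <= t < f k.+1)%O.
Proof.
move=> f0 fk; case: (ex_minnP fk) => -[|k] tk mink; first by rewrite ltNge f0 in tk.
by exists k; rewrite tk andbT leNgt; apply/negP => /mink; rewrite ltnn.
Qed.

Section Switching.
Variables (R : realType) (n N q : nat) (S : 'M[R]_(q, n)).
Variables (ts : nat -> R) (js : nat -> nat) (tau beta eps K theta delta Tc : R).
Variables (Phi : R -> 'M[R]_n) (P : nat -> 'M[R]_N) (E : R -> 'M[R]_(n, N)).
Hypothesis tau0 : 0 < tau.
Hypothesis ts0 : ts 0%N = 0.
Hypothesis tsS : forall r, ts r.+1 - ts r >= tau.
Hypothesis js0 : js 0%N = 0%N.
Hypothesis jsS : forall k, (js k < js k.+1)%N.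
Hypothesis tsjs : forall k, ts (js k.+1) - ts (js k) <= Tc.
Hypothesis beta0 : 0 <= beta.
Hypothesis eps01 : 0 <= eps <= 1.
Hypothesis K0 : 0 <= K.
Hypothesis Phi_le : forall h (Y : 'M[R]_(n, N)), 0 <= h ->
  fnorm (S *m (Phi h *m Y)) <= expR (beta * h) * fnorm (S *m Y).
Hypothesis P_le : forall r (Y : 'M[R]_(n, N)), fnorm (S *m (Y *m P r)) <= fnorm (S *m Y).
Hypothesis P_sym : forall r, (P r)^T = P r.
Hypothesis step : forall r,
  fnorm (S *m (E (ts r.+1) - Phi (ts r.+1 - ts r) *m (E (ts r) *m P r)))
    <= eps * fnorm (S *m E (ts r)).
Hypothesis inter : forall r t, ts r <= t <= ts r.+1 ->
  fnorm (S *m (E t - Phi (t - ts r) *m (E (ts r) *m P r))) <= K * fnorm (S *m E (ts r)).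
Hypothesis delta0 : 0 <= delta.
Hypothesis Pdelta : forall k,
  opnorm (\prod_(r <- rev (index_iota (js k) (js k.+1))) P r) <= delta.
Hypothesis theta01 : 0 < theta < 1.

Let B := expR (beta * Tc) + 1.
(** The dwell time allows at most this many full intervals in a cycle. *)
Let J := Num.truncn (Tc / tau).

Hypothesis theta_ge : delta * expR (beta * Tc) + eps * (J%:R * B ^+ J) <= theta.

Lemma switch_le r : ts r <= ts r.+1.
Proof. by have := tau0; have := tsS r; lra. Qed.

Lemma switch_dist r s : s%:R * tau <= ts (r + s) - ts r.
Proof.
elim: s => [|s IH]; first by rewrite addn0 subrr mul0r.
by rewrite addnS -natr1; have := tsS (r + s); lra.
Qed.

Lemma switch_mono r s : (r <= s)%N -> ts r <= ts s.
Proof.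
move=> rs; have := switch_dist r (s - r); rewrite subnKC // => h.
by have : 0 <= (s - r)%:R * tau by [rewrite mulr_ge0 // ltW]; lra.
Qed.

Lemma switch_gt t : 0 <= t -> t < ts (Num.truncn (t / tau)).+1.
Proof.
move=> t0; have := switch_dist 0 (Num.truncn (t / tau)).+1.
rewrite add0n ts0 subr0; apply: lt_le_trans; rewrite -ltr_pdivrMr //.
by have /andP[] := truncn_itv (divr_ge0 t0 (ltW tau0)).
Qed.

Lemma locate_switch t : 0 <= t -> exists r, ts r <= t < ts r.+1.
Proof.
move=> t0; apply: locate_interval; first by rewrite ts0.
by exists (Num.truncn (t / tau)).+1; exact: switch_gt.
Qed.

Lemma cycle_length r s : ts (r + s) - ts r <= Tc -> (s <= J)%N.
Proof.
move=> rs; have h := switch_dist r s.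
have sT : s%:R <= Tc / tau by rewrite ler_pdivlMr // (le_trans h).
have T0 : 0 <= Tc / tau by apply: le_trans sT.
rewrite -ltnS -(ltr_nat R) (le_lt_trans sT) //.
by have /andP[] := truncn_itv T0.
Qed.

Lemma cycle_start k : fnorm (S *m E (ts (js k))) <= theta ^+ k * fnorm (S *m E 0).
Proof.
elim: k => [|k IH]; first by rewrite js0 ts0 expr0 mul1r.
have [th0 th1] := andP theta01.
have jk : js k.+1 = (js k + (js k.+1 - js k))%N by rewrite subnKC // ltnW.
rewrite exprS -mulrA; apply: le_trans (ler_wpM2l (ltW th0) IH).
have Tk := tsjs k; have Pk := Pdelta k; rewrite jk in Tk Pk *.
apply: le_trans (ler_wpM2r (fnorm_ge0 _) theta_ge).
apply: (cycle_contraction (X := fun r => E (ts r)) beta0 eps01 switch_le Phi_le P_le P_sym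
  step delta0 (cycle_length Tk) Tk Pk).
Qed.

Lemma switching_decay : 0 < Tc -> exists c alpha : R, 0 < alpha /\
  forall t, 0 <= t -> fnorm (S *m E t) <= c * expR (- alpha * t).
Proof.
move=> Tc0; have [th0 th1] := andP theta01.
have lth : ln theta < 0 by apply: ln_lt0; rewrite th0.
have B1 : 1 <= B by rewrite lerDr expR_ge0.
set u := fnorm (S *m E 0).
(* [B ^+ J] covers the earlier intervals of the current cycle and [B + K] the current interval;
   [theta^-1] appears because [t] can reach [k.+1%:R * Tc] with only [k] cycles completed. *)
exists ((B + K) * B ^+ J * theta^-1 * u), (- ln theta / Tc); split.
  by rewrite divr_gt0 // oppr_gt0.
move=> t t0.
have [r /andP[tr rt]] := locate_switch t0.
have [k /andP[kr rk]] : exists k, (js k <= r < js k.+1)%N.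
  apply: (@locate_interval _ nat js r); first by rewrite js0.
  exists r.+1; rewrite ltEnat /=; elim: r.+1 => // i IH; exact: leq_ltn_trans IH (jsS i).
have rE : r = (js k + (r - js k))%N by rewrite subnKC.
have Tk := tsjs k.
have rT : ts r - ts (js k) <= Tc by have := switch_mono (ltnW rk); lra.
have Tr : t - ts r <= Tc.
  by have := switch_mono rk; have := switch_mono kr; lra.
have sJ : (r - js k <= J)%N by apply: (@cycle_length (js k)); rewrite -rE.
have u0 : 0 <= u by exact: fnorm_ge0.
have Er : fnorm (S *m E (ts r)) <= B ^+ J * (theta ^+ k * u).
  rewrite rE in rT *.
  have := cycle_growth (X := fun r => E (ts r)) beta0 eps01 switch_le Phi_le P_le step rT.
  move=> /le_trans; apply; apply: ler_pM.
  - by rewrite exprn_ge0 // (le_trans ler01).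
  - exact: fnorm_ge0.
  - by rewrite ler_weXn2l.
  - exact: cycle_start.
have Et : fnorm (S *m E t) <= (B + K) * fnorm (S *m E (ts r)).
  have trt : ts r <= t <= ts r.+1 by rewrite tr ltW.
  have := inter trt; set Y := Phi _ *m _ => D.
  rewrite -(subrK Y (E t)) mulmxDr (le_trans (fnormD _ _)) // addrC mulrDl lerD //.
  rewrite (le_trans (Phi_le _ _)) ?subr_ge0 //.
  apply: ler_pM; rewrite ?expR_ge0 ?fnorm_ge0 ?P_le //.
  rewrite /B -[leLHS]addr0 lerD // ler_expR ler_wpM2l //.
have thk : theta ^+ k <= theta^-1 * expR (- (- ln theta / Tc) * t).
  rewrite ler_pdivlMl // -exprS -{1}(lnK (x := theta)) ?posrE // -expRM_natl ler_expR.
  have : t <= k.+1%:R * Tc.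
    apply: le_trans (ltW rt) _.
    have /le_trans : ts r.+1 <= ts (js k.+1) by exact: switch_mono.
    apply; elim: k.+1 => [|i IH]; first by rewrite js0 ts0 mul0r.
    by have := tsjs i; rewrite -natr1; lra.
  rewrite -ler_pdivrMr // => tk.
  have -> : - (- ln theta / Tc) * t = t / Tc * ln theta by ring.
  by rewrite ler_wnM2r // ltW.
apply: (le_trans Et).
have -> : (B + K) * B ^+ J * theta^-1 * u * expR (- (- ln theta / Tc) * t) =
  (B + K) * (B ^+ J * (theta^-1 * expR (- (- ln theta / Tc) * t) * u)) by ring.
have B0 : 0 <= B by apply: le_trans B1.
rewrite ler_wpM2l ?addr_ge0 // (le_trans Er) // ler_wpM2l ?exprn_ge0 //.
by rewrite ler_wpM2r.
Qed.

End Switching.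

(** * Existence of solutions *)

Section Patching.
Variables (R : realType) (a b : nat) (f : nat -> 'M[R]_(a, b) -> 'M[R]_(a, b)).
Variables (flow : nat -> 'M[R]_(a, b) -> R -> 'M[R]_(a, b)).
Variables (ts : nat -> R) (tau : R) (X0 : 'M[R]_(a, b)).
Hypothesis flow0 : forall r X, flow r X 0 = X.
Hypothesis dflow : forall r X t i j,
  is_derive t (1 : R) (fun s => flow r X s i j) (f r (flow r X t) i j).
Hypothesis tau0 : 0 < tau.
Hypothesis ts0 : ts 0%N = 0.
Hypothesis tsS : forall r, ts r.+1 - ts r >= tau.
Local Open Scope classical_set_scope.

Let flow_at r X t := flow r X (t - ts r).

(** Only the first [r] switchings are carried out: past [ts r] the function follows flow [r]
    forever, so it is defined on the whole line. *)
Fixpoint patch r : R -> 'M[R]_(a, b) :=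
  if r is r'.+1 then
    fun t => if t <= ts r then patch r' t else flow_at r (patch r' (ts r)) t
  else flow_at 0 X0.

Let continuous_glue (g h : R -> R) c : continuous g -> continuous h -> g c = h c ->
  continuous (fun t => if t <= c then g t else h t).
Proof.
move=> gc hc ghc; apply/continuous_subspace_setT.
have -> : [set: R] = `]-oo, c] `|` `[c, +oo[.
  apply/seteqP; split=> // x _ /=; rewrite !in_itv /= andbT.
  by case: (leP x c) => [|/ltW]; [left|right].
apply: withinU_continuous.
- exact: interval_closed.
- exact: interval_closed.
- apply: (subspace_eq_continuous (f := g)); last exact: continuous_subspaceT.
  move=> x; rewrite inE /= in_itv => /= xc.
  by change (g x = if x <= c then g x else h x); rewrite xc.
apply: (subspace_eq_continuous (f := h)); last exact: continuous_subspaceT.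
move=> x; rewrite inE /= in_itv /= andbT => cx.
change (h x = if x <= c then g x else h x); case: leP => // xc.
by rewrite (le_anti (introT andP (conj xc cx))) ghc.
Qed.

Let continuous_flow_at r X i j : continuous (fun t => flow_at r X t i j).
Proof.
move=> t; apply: differentiable_continuous; apply/derivable1_diffP.
by case: (is_derive_shift (dflow r X (t - ts r) i j)).
Qed.

Let continuous_patch r i j : continuous (fun t => patch r t i j).
Proof.
elim: r => [|r IH] /=; first exact: continuous_flow_at.
rewrite (_ : (fun t => _) = fun t => if t <= ts r.+1 then patch r t i j
    else flow_at r.+1 (patch r (ts r.+1)) t i j).
  apply: (continuous_glue (g := fun t => patch r t i j)
    (h := fun t => flow_at r.+1 (patch r (ts r.+1)) t i j) IH).
    exact: continuous_flow_at.
  by rewrite /flow_at subrr flow0.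
by apply/funext => t; case: ifP.
Qed.

Let patchD r s t : t <= ts r.+1 -> patch (r + s) t = patch r t.
Proof.
move=> tr; elim: s => [|s IH]; first by rewrite addn0.
rewrite addnS /= ifT //; apply: (le_trans tr).
have : ts r.+1 <= ts (r.+1 + s) by exact: (switch_mono tau0 tsS (leq_addr _ _)).
by rewrite addSn.
Qed.

Let patch_eq r s t : t <= ts r.+1 -> t <= ts s.+1 -> patch r t = patch s t.
Proof.
move=> tr tS; case: (leqP r s) => [rs|/ltnW rs].
  by rewrite -(subnKC rs) patchD.
by rewrite -(subnKC rs) patchD.
Qed.

(** By the dwell time a nonnegative [t] precedes the switching instant of index one more than this
    [truncn], so the chosen patch is already final at [t]. *)
Definition patched (t : R) := patch (Num.truncn (t / tau)) t.

Let patchedE r t : t <= ts r.+1 -> patched t = patch r t.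
Proof.
move=> tr; apply: patch_eq => //.
have [t0|t0] := leP 0 t.
  exact: ltW (switch_gt tau0 ts0 tsS t0).
apply: (le_trans (ltW t0)); rewrite -ts0; exact: (switch_mono tau0 tsS (leq0n _)).
Qed.

Lemma patched0 : patched 0 = X0.
Proof.
rewrite (@patchedE 0%N) /= /flow_at ?ts0 ?subr0 //.
by rewrite -ts0; exact: (switch_mono tau0 tsS (leq0n _)).
Qed.

Lemma continuous_patched i j : continuous (fun t => patched t i j).
Proof.
move=> t; have [r tr] : exists r, t < ts r.+1.
  exists (Num.truncn (`|t| / tau)); apply: (le_lt_trans (ler_norm _)).
  exact: switch_gt tau0 ts0 tsS _ (normr_ge0 t).
rewrite /continuous_at (patchedE (ltW tr)).
apply: cvg_trans _ (@continuous_patch r i j t).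
apply: near_eq_cvg; near=> s; rewrite (@patchedE r) // ltW //.
by near: s; exact: lt_nbhsl.
Unshelve. all: by end_near. Qed.

Lemma is_derive_patched r t i j : ts r < t < ts r.+1 ->
  is_derive t (1 : R) (fun s => patched s i j) (f r (patched t) i j).
Proof.
move=> /andP[rt tr].
pose Z := if r is r'.+1 then patch r' (ts r) else X0.
have pE s : ts r < s < ts r.+1 -> patched s = flow_at r Z s.
  move=> /andP[rs sr]; rewrite (@patchedE r) ?ltW // /Z; case: (r) rs => //= r' rs.
  by rewrite leNgt rs.
rewrite pE ?rt //; apply: (near_eq_is_derive (f := fun s => flow_at r Z s i j)).
  by near=> s; rewrite pE //; apply/andP; split; near: s; [exact: lt_nbhsr|exact: lt_nbhsl].
exact: is_derive_shift (dflow r Z (t - ts r) i j).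
Unshelve. all: by end_near. Qed.

End Patching.

Definition err_mx (R : pzRingType) n N (eta : 'I_N.+1 -> 'cV[R]_n) : 'M[R]_(n, N) :=
  \matrix_(k, i) (eta (node i) k 0 - eta ord0 k 0).

Lemma col_err_mx (R : pzRingType) n N (eta : 'I_N.+1 -> 'cV[R]_n) i :
  col i (err_mx eta) = eta (node i) - eta ord0.
Proof. by apply/matrixP => k l; rewrite !mxE ord1. Qed.

(** The leader state cancels from the relative terms: followers contribute differences of errors,
    and the edge from the leader minus the error itself. Symmetry lets [H] multiply on the right
    untransposed. *)
Lemma observer_error_rhs (R : realFieldType) n N n0 (A B : 'M[R]_n)
    (Ebar : 'I_n0 -> rel 'I_N.+1) (p : 'I_n0) (eta : 'I_N.+1 -> 'cV[R]_n) i :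
  (forall p i, ~~ Ebar p i i) ->
  (forall i j : 'I_N, Ebar p (node j) (node i) = Ebar p (node i) (node j)) ->
  A *m eta (node i) + B *m (\sum_(j < N.+1)
      adj R Ebar p (node i) j *: (eta j - eta (node i))) - A *m eta ord0 =
  col i (errf A B (Hmat R Ebar p) (err_mx eta)).
Proof.
move=> irrE symE.
have -> : \sum_(j < N.+1) adj R Ebar p (node i) j *: (eta j - eta (node i)) =
    - col i (err_mx eta *m Hmat R Ebar p).
  apply/matrixP => k l; rewrite summxE [RHS]mxE [col _ _ _ _]mxE (mulmx_HmatE irrE symE).
  rewrite big_ord_recl opprD -sumrN addrC ord1; congr (_ + _).
    by apply: eq_bigr => j _; rewrite !mxE -/(node j); ring.
  by rewrite !mxE; ring.
rewrite /errf mulmxN addrAC -mulmxBr -col_err_mx.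
by rewrite !colE mulmxBl !mulmxA.
Qed.

Section Observer.
Variables (R : realType) (n m N n0 : nat) (A : 'M[R]_n) (C : 'M[R]_(m, n)).
Variables (L : 'M[R]_(n, m)) (Ebar : 'I_n0 -> rel 'I_N.+1).
Variables (sigma : R -> 'I_n0) (tsw : nat -> R) (tau : R).
Hypothesis irrE : forall p i, ~~ Ebar p i i.
Hypothesis tau0 : 0 < tau.
Hypothesis tsw0 : tsw 0%N = 0.
Hypothesis tswS : forall r, tsw r.+1 - tsw r >= tau.
Hypothesis sigmaE : forall r s, tsw r <= s < tsw r.+1 -> sigma s = sigma (tsw r).
Hypothesis symE : forall t, 0 <= t -> forall i j : 'I_N,
  Ebar (sigma t) (node j) (node i) = Ebar (sigma t) (node i) (node j).
Local Open Scope classical_set_scope.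

Let H r := Hmat R Ebar (sigma (tsw r)).

Lemma tsw_ge0 r : 0 <= tsw r.
Proof. by rewrite -tsw0; exact: (switch_mono tau0 tswS (leq0n _)). Qed.

Lemma tsw_not_between r t s : tsw r < t < tsw r.+1 -> t <> tsw s.
Proof.
move=> /andP[rt tr] ts; case: (leqP s r) => [sr|rs].
  by have := switch_mono tau0 tswS sr; rewrite -ts leNgt rt.
by have := switch_mono tau0 tswS rs; rewrite -ts leNgt tr.
Qed.

Lemma observer_error_solves (eta : 'I_N.+1 -> R -> 'cV[R]_n) r :
  is_solution A C L Ebar sigma tsw eta ->
  solves_on (errf A (L *m C) (H r)) (tsw r) (tsw r.+1) (fun t => err_mx (eta^~ t)).
Proof.
move=> [etac [lead foll]]; have r0 := tsw_ge0 r.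
split=> [k i|t rtr k i].
  rewrite (_ : (fun t => _) = (fun t => eta (node i) t k 0) - (fun t => eta ord0 t k 0)).
    apply: (@continuous_subspaceW _ _ _ [set s : R | 0 <= s]).
      by move=> t /=; rewrite in_itv /= => /andP[+ _]; exact: le_trans.
    by apply: within_continuousB; exact: etac.
  by apply/funext => t; rewrite mxE.
have [rt tr] := andP rtr; have t0 : 0 < t by apply: le_lt_trans rt.
rewrite (_ : (fun t => _) = (fun t => eta (node i) t k 0) - (fun t => eta ord0 t k 0)).
  have tE : sigma t = sigma (tsw r) by apply: sigmaE; rewrite tr ltW.
  have <- : (col i (errf A (L *m C) (H r) (err_mx (eta^~ t)))) k 0 =
      errf A (L *m C) (H r) (err_mx (eta^~ t)) k i by rewrite mxE.
  rewrite -observer_error_rhs //; last exact: symE.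
  have subE (u w : 'cV[R]_n) : (u - w) k 0 = u k 0 - w k 0 by rewrite !mxE.
  rewrite -tE subE; apply: is_deriveB; last exact: lead.
  exact: (foll i t t0 (fun s => tsw_not_between rtr)).
by apply/funext => s; rewrite mxE.
Qed.

(** The error equation does not involve the leader, so both are solved separately and each observer
    is the leader plus an error column. *)
Lemma observer_solution_exists (e0 : 'I_N.+1 -> 'cV[R]_n) :
  exists eta : 'I_N.+1 -> R -> 'cV[R]_n,
    is_solution A C L Ebar sigma tsw eta /\ (forall k, eta k 0 = e0 k).
Proof.
pose f r (X : 'M[R]_(n, N)) := errf A (L *m C) (H r) X.
have exflow (rX : nat * 'M[R]_(n, N)) : exists x : R -> 'M[R]_(n, N),
    x 0 = rX.2 /\ forall t i j,
      is_derive t (1 : R) (fun s => x s i j) (f rX.1 (x t) i j).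
  case: rX => r X /=; have [x [x0 dx]] := sylvester_flow A (- (L *m C)) (H r) X.
  by exists x; split=> // t i j; have := dx t i j; rewrite !mulNmx.
have [flow flowP] := choice exflow.
have [x0 [x00 dx0]] := sylvester_flow A 0 0 (e0 ord0).
have {}dx0 t k : is_derive t (1 : R) (fun s => x0 s k 0) ((A *m x0 t) k 0).
  by have := dx0 t k 0; rewrite mulmx0 addr0.
have f0 r X : flow (r, X) 0 = X by have [] := flowP (r, X).
have df r X t i j : is_derive t (1 : R) (fun s => flow (r, X) s i j) (f r (flow (r, X) t) i j).
  by have [_] := flowP (r, X); apply.
pose E := patched (fun r X => flow (r, X)) tsw tau (err_mx e0).
have E0 : E 0 = err_mx e0 by exact: patched0.
have Ec i j : continuous (fun t => E t i j) by exact: (continuous_patched f0 df).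
have dE := is_derive_patched (err_mx e0) df tau0 tsw0 tswS.
have x0c k : continuous (fun t => x0 t k 0).
  by move=> t; apply: differentiable_continuous; apply/derivable1_diffP; case: (dx0 t k).
pose eta k t : 'cV[R]_n := if unlift ord0 k is Some i then x0 t + col i (E t) else x0 t.
have eta0 t : eta ord0 t = x0 t by rewrite /eta unlift_none.
have etaS i t : eta (node i) t = x0 t + col i (E t) by rewrite /eta /node liftK.
have errE t : err_mx (eta^~ t) = E t.
  by apply/matrixP => k i; rewrite !mxE etaS eta0 !mxE addrAC subrr add0r.
exists eta; split; last first.
  move=> k; case: (unliftP ord0 k) => [i ->|->]; last by rewrite eta0.
  by rewrite -/(node i) etaS E0 x00 col_err_mx addrC subrK.
split; [|split].
- move=> k i; apply: continuous_subspaceT.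
  case: (unliftP ord0 k) => [j ->|->]; last first.
    by under eq_fun do rewrite eta0; exact: x0c.
  rewrite (_ : (fun t => _) = (fun t => x0 t i 0) + (fun t => E t i j)).
    by move=> t; apply: cvgD; [exact: x0c|exact: Ec].
  by apply/funext => t; rewrite -/(node j) etaS !mxE.
- by move=> t _ k; rewrite eta0; under eq_fun do rewrite eta0; exact: dx0.
move=> i t t0 tn k.
have [r /andP[rt tr]] := locate_switch tau0 tsw0 tswS (ltW t0).
have {}rt : tsw r < t by rewrite lt_neqAle rt andbT; apply/eqP => /esym; exact: tn.
have tE : sigma t = sigma (tsw r) by apply: sigmaE; rewrite tr ltW.
rewrite (_ : (fun s => _) = (fun s => x0 s k 0) + (fun s => E s k i)); last first.
  by apply/funext => s; rewrite etaS !mxE.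
set v := A *m eta (node i) t + _; have -> : v k 0 = (A *m x0 t) k 0 + f r (E t) k i.
  have -> : f r (E t) k i = (v - A *m eta ord0 t) k 0.
    rewrite /v (@observer_error_rhs _ _ _ _ A (L *m C) Ebar (sigma t) (eta^~ t)) //.
      by rewrite errE [RHS]mxE tE.
    by apply: symE; exact: ltW.
  have subE (u w : 'cV[R]_n) : (u - w) k 0 = u k 0 - w k 0 by rewrite !mxE.
  by rewrite eta0 subE addrC subrK.
apply: is_deriveD.
by apply: dE; rewrite rt tr.
Qed.

End Observer.

(** * The distributed observer *)

(** A minimum over finitely many graphs. Symmetry is known only for graphs that the signal visits,
    hence the implication after [p]; for the others the value [1] is a placeholder. *)
Lemma uniform_coercivity (R : realFieldType) (N n0 : nat)
    (Ebar : 'I_n0 -> rel 'I_N.+1) (P : 'I_n0 -> 'M[R]_N) :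
  (forall p i, ~~ Ebar p i i) ->
  (forall p, orth_proj_ker (Hmat R Ebar p) (P p)) ->
  exists2 mu : R, 0 < mu & forall p,
    (forall i j : 'I_N, Ebar p (node j) (node i) = Ebar p (node i) (node j)) ->
    forall b (Z : 'M[R]_(b, N)),
      mu * fsq (Z *m (1%:M - P p)) <= fdot (Z *m Hmat R Ebar p) Z.
Proof.
move=> irrE HP.
have ex p : exists mu : R, 0 < mu /\ (
    (forall i j : 'I_N, Ebar p (node j) (node i) = Ebar p (node i) (node j)) ->
    forall b (Z : 'M[R]_(b, N)),
      mu * fsq (Z *m (1%:M - P p)) <= fdot (Z *m Hmat R Ebar p) Z).
  case: (pselect (forall i j : 'I_N, Ebar p (node j) (node i) = Ebar p (node i) (node j))).
    move=> symE; have [mu mu0 mule] := orth_proj_ker_coercive (trmx_Hmat R irrE symE)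
      (fun b Z => Hmat_psd irrE symE Z) (HP p).
    by exists mu.
  by move=> nsym; exists 1; split.
have [mu mup] := choice ex.
have [m m0 mm] : exists2 m, m < 0 & forall p, - mu p <= m.
  by apply: finite_lt_uniform => p; rewrite oppr_lt0; have [] := mup p.
exists (- m); first by rewrite oppr_gt0.
move=> p symE b Z; have [_ /(_ symE b Z)] := mup p; apply: le_trans.
by rewrite ler_wpM2r ?fsq_ge0 // lerNl.
Qed.

Theorem theorem2 (R : realType) (n m N n0 : nat)
  (A : 'M[R]_n) (C : 'M[R]_(m, n))
  (Ebar : 'I_n0 -> rel 'I_N.+1)
  (sigma : R -> 'I_n0) (tsw : nat -> R) (tau : R)
  (Tc : R) (js : nat -> nat) (P : 'I_n0 -> 'M[R]_N) (delta : R) :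
  observable C A ->
  (* graphs: edges are pairs (j, i) with j <> i *)
  (forall p i, ~~ Ebar p i i) ->
  (* piecewise constant switching signal with dwell time tau *)
  0 < tau -> tsw 0%N = 0 ->
  (forall r, tsw r.+1 - tsw r >= tau) ->
  (forall r s, tsw r <= s < tsw r.+1 -> sigma s = sigma (tsw r)) ->
  (* (i) the follower subgraph is undirected for all t >= 0 *)
  (forall t, 0 <= t -> forall i j : 'I_N,
      Ebar (sigma t) (node j) (node i) = Ebar (sigma t) (node i) (node j)) ->
  (* (ii) jointly connected with respect to the subsequence t_{j_k} *)
  0 < Tc -> js 0%N = 0%N ->
  (forall k, (js k < js k.+1)%N) ->
  (forall k, tsw (js k.+1) - tsw (js k) <= Tc) ->
  (forall k (i : 'I_N),
      connect (fun a b => has (fun r => Ebar (sigma (tsw r)) a b)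
                              (index_iota (js k) (js k.+1)))
              ord0 (node i)) ->
  (* P_p is the orthogonal projection onto ker H_p *)
  (forall p, orth_proj_ker (Hmat R Ebar p) (P p)) ->
  0 < delta < 1 ->
  (forall k, opnorm (\prod_(r <- rev (index_iota (js k) (js k.+1))) P (sigma (tsw r)))
             <= delta) ->
  lambda_max_lt A (- ln delta / Tc) ->
  exists L : 'M[R]_(n, m),
    forall e0 : 'I_N.+1 -> 'cV[R]_n,
      (exists eta : 'I_N.+1 -> R -> 'cV[R]_n,
          is_solution A C L Ebar sigma tsw eta /\ (forall k, eta k 0 = e0 k)) /\
      (forall eta : 'I_N.+1 -> R -> 'cV[R]_n,
          is_solution A C L Ebar sigma tsw eta -> (forall k, eta k 0 = e0 k) ->
          exists c alpha : R, 0 < alpha /\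
            forall (i : 'I_N) t, 0 <= t ->
              enorm (eta (node i) t - eta ord0 t) <= c * expR (- alpha * t)).
Proof.
move=> obs irrE tau0 tsw0 tswS sigmaE symE Tc0 js0 jsS tswjs _ HP /andP[d0 d1] Pd Alam.
have [beta0 [beta0_lt [S [G [GS Sbeta0]]]]] := adapted_norm Alam.
(* With a nonnegative exponent, shorter times can be replaced by [Tc] in the growth bounds; the
   strict inequality survives because [- ln delta] is positive. *)
pose beta := Num.max beta0 0.
have beta_ge0 : 0 <= beta by rewrite le_max lexx orbT.
have Sbeta b (X : 'M[R]_(n, b)) :
    fdot (S *m (A *m X)) (S *m X) <= beta * fsq (S *m X).
  by rewrite (le_trans (Sbeta0 _ _)) // ler_wpM2r ?fsq_ge0 // le_max lexx.
have lnd : 0 < - ln delta by rewrite oppr_gt0 ln_lt0 // d0.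
have beta_lt : beta * Tc < - ln delta.
  by rewrite -ltr_pdivlMr // gt_max beta0_lt divr_gt0.
pose a := delta * expR (beta * Tc).
have a0 : 0 < a by rewrite mulr_gt0 ?expR_gt0.
have a1 : a < 1.
  rewrite /a -{1}(lnK (x := delta)) ?posrE // -expRD -expR0 ltr_expR.
  by move: beta_lt; lra.
pose JB := (Num.truncn (Tc / tau))%:R * (expR (beta * Tc) + 1) ^+ Num.truncn (Tc / tau).
have JB0 : 0 <= JB by rewrite mulr_ge0 // exprn_ge0 // addr_ge0 // expR_ge0.
(* Half of the margin [1 - a] is granted to the errors of a cycle, leaving the factor [(1 + a) / 2];
   the added [1] keeps the denominator positive. *)
pose eps := Num.min 1 ((1 - a) / 2 / (JB + 1)).
have eps0 : 0 < eps by rewrite lt_min ltr01 !divr_gt0 // ?subr_gt0 // ltr_wpDl.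
have eps1 : 0 <= eps <= 1 by rewrite ltW // ge_min lexx.
have theta_ge : a + eps * JB <= (1 + a) / 2.
  have : eps * (JB + 1) <= (1 - a) / 2.
    by rewrite -ler_pdivlMr ?ltr_wpDl // ge_min lexx orbT.
  by move: (ltW eps0); lra.
have theta01 : 0 < (1 + a) / 2 < 1 by apply/andP; split; lra.
have [mu mu0 coer] := uniform_coercivity irrE HP.
have [L [K [K0 gain]]] := high_gain obs GS mu0 tau0 eps0.
have [Phi [Phi0 dPhi]] := sylvester_flow A 0 0 (1%:M : 'M[R]_n).
have {}dPhi t i j : is_derive t (1 : R) (fun s => Phi s i j) ((A *m Phi t) i j).
  by have := dPhi t i j; rewrite mulmx0 addr0.
exists L => e0; split.
  exact: (observer_solution_exists A C L irrE tau0 tsw0 tswS sigmaE symE e0).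
move=> eta etasol _; pose E t := err_mx (eta^~ t).
pose Pr r := P (sigma (tsw r)).
have Esol r : solves_on (errf A (L *m C) (Hmat R Ebar (sigma (tsw r)))) (tsw r) (tsw r.+1) E.
  exact: (observer_error_solves irrE tau0 tsw0 tswS sigmaE symE r etasol).
have symr r := symE (tsw r) (tsw_ge0 tau0 tsw0 tswS r).
have trHr r := trmx_Hmat R irrE (symr r).
(* The deviation from the ideal flow is exactly the part of [E] outside the kernel, which the gain
   controls. *)
have EP r t : tsw r <= t <= tsw r.+1 ->
    E t - Phi (t - tsw r) *m (E (tsw r) *m Pr r) = E t *m (1%:M - Pr r).
  move=> /andP[rt tr]; have := solves_on_sub tr (Esol r) => Et.
  rewrite -(errf_kernel_part GS Sbeta Phi0 dPhi (orth_proj_ker0 (HP _)) rt Et).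
  by rewrite mulmxBr mulmx1.
have gainr r t (rt : tsw r <= t) (tr : t <= tsw r.+1) :=
  gain N _ _ _ _ _ (HP (sigma (tsw r))) (coer _ (symr r)) (trHr r) rt
    (solves_on_sub tr (Esol r)).
have rS r : tsw r <= tsw r.+1 := switch_mono tau0 tswS (leqnSn r).
have Prs r : (Pr r)^T = Pr r by have [] := HP (sigma (tsw r)).
have PrP r : Pr r *m Pr r = Pr r by have [_ []] := HP (sigma (tsw r)).
have Pr_le r (Y : 'M[R]_(n, N)) : fnorm (S *m (Y *m Pr r)) <= fnorm (S *m Y).
  by rewrite mulmxA ler_wsqrtr // fsq_proj_le.
have stepr r : fnorm (S *m (E (tsw r.+1) - Phi (tsw r.+1 - tsw r) *m (E (tsw r) *m Pr r)))
    <= eps * fnorm (S *m E (tsw r)).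
  by rewrite EP ?rS ?lexx //; have [_ ->] := gainr r _ (rS r) (lexx _).
have interr r t : tsw r <= t <= tsw r.+1 ->
    fnorm (S *m (E t - Phi (t - tsw r) *m (E (tsw r) *m Pr r))) <= K * fnorm (S *m E (tsw r)).
  by move=> rt; rewrite EP //; have [/gainr] := andP rt => h /h[].
have [c [alpha [alpha0 decay]]] := switching_decay tau0 tsw0 tswS js0 jsS tswjs beta_ge0 eps1
  K0 (fun h Y h0 => flow_le Sbeta Phi0 dPhi Y h0) Pr_le Prs stepr interr (ltW d0) Pd
  theta01 theta_ge Tc0.
(* [G] undoes the weight [S], and a column is bounded by the whole error matrix. *)
exists (fnorm G * c), alpha; split=> // i t t0.
rewrite enorm_fnorm -(col_err_mx (eta^~ t)) -/(E t).
have colE : fnorm (col i (E t)) <= fnorm (E t).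
  rewrite ler_wsqrtr // [leRHS]fdot_cols (bigD1 i) //= lerDl.
  by apply: sumr_ge0 => j _; exact: fsq_ge0.
apply: (le_trans colE); rewrite -[E t]mul1mx -GS -mulmxA -mulrA.
apply: (@le_trans _ _ (fnorm G * fnorm (S *m E t))).
  by apply: fnorm_le; rewrite ?fnorm_ge0 // sqr_fnorm fsqM.
by rewrite ler_wpM2l ?fnorm_ge0 // decay.
Qed.
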